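(* For every network $\mathbf{G}$, every fixpoint formula $\mu(\varphi(T))$ and every relation $I$: $\mathbf{G},I\models\mu(\varphi(T))$ if and only if $\mathbf{G},I\vdash_{FP}\mu(\varphi(T))$.
   Context: Networks: $U$ is an infinite linearly ordered set of node identifiers. A network $\mathbf{G}=(V,G)$ is a finite, connected, undirected graph with $V\subset U$ and symmetric edge relation $G$, of degree bounded by a constant $D$; $n=|V|$ and $\Delta$ is the diameter. The model is synchronous message passing. Each node knows its own identifier, its neighbours' identifiers, $n$ and $\Delta$. In each round every node performs local computation and then broadcasts messages to all its neighbours, which receive them. A query is posed by a requesting node. Fixpoint formulas: $\varphi(T;x_1,\dots,x_\ell)$ is a first-order formula over $\{G,T\}$, with $T$ a new relation symbol of arity $\ell$. $\mathbf{G},I\models\mu(\varphi(T))$ means that $I$ is the inflationary fixpoint of $I_0=\emptyset$, $I_{i+1}=\varphi(I_i)\cup I_i$, where $\varphi(I_i)=\{\bar a: \mathbf{G}\models\varphi(\bar a)$ with $T$ interpreted as $I_i\}$. $\mathbf{G},I\vdash_{FP}\mu(\varphi(T))$ means that, upon request of $\mu(\varphi(T))$ from any node, the query engine $\mathcal{QE}_{FP}$ produces the answer $I$ distributed in the network, i.e. $I$ is the union of the local tables for $T$. The first-order engine $\mathcal{QE}_{FO}$ works as follows. - Messages and tables. It uses Boolean queries $?B\varphi$, partially instantiated queries $?x_1\dots ?x_i\,!a_{i+1}\dots !a_\ell\,\varphi$, and Boolean answers $!B\varphi$. Each node keeps a query table of (query, parent query) pairs and an answer table. - Local simplification. Each node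 replaces by their truth values the atoms it can decide locally: atoms over its own incident edges, equalities between constants, and (for $\mathcal{QE}_{FP}$ below) atoms $T(a,\dots)$ with $a$ its own identifier, decided from its local table. - Handling a query. A node receiving a new query records and broadcasts it. - If free variables remain, it instantiates the rightmost free variable by its own identifier. When all are instantiated, node $a_1$ issues $?B\varphi(a_1,\dots,a_\ell)$. - For a Boolean query $Qx\,\psi$ ($Q$ the leftmost quantifier), it instantiates $x$ by its own identifier, giving a witness (if $Q=\exists$ and $\psi(a)$ is true) or a counterevidence (if $Q=\forall$ and $\psi(a)$ is false), or a subquery that is broadcast and handled recursively. - Clocks and answers. A waiting node uses a clock of $2\Delta w'$ rounds ($w'$ the number of variables and constants of the query). Without a witness, $\exists$ defaults to false; without a counterevidence, $\forall$ defaults to true. Answers propagate back to the waiting nodes. - Storing results. A positively answered fully instantiated query $?B\varphi(a_1,\dots,a_\ell)$ makes node $a_1$ store $(a_1,\dots,a_\ell)$. The fixpoint engine $\mathcal{QE}_{FP}$ works as follows. - Flooding. The requesting node sets a clock $\sigma=\Delta$ and sends $(\mu(\varphi(T)),\Delta-1)$ to its neighbours. A node receiving $(\mu(\varphi(T)),c)$ that has not yet set $\sigma$ sets $\sigma=c$ and forwards $(\mu(\varphi(T)),c-1)$ unless $c=0$. - Stages. When $\sigma$ expires, each node $a$ creates a local table for $T$ (initially empty) and iterates stages. Let $w$ be the number of variables and constants of $\varphi(T)$. - Node $a$ sets a clock $\tau=2\Delta w$ and evaluates with $\mathcal{QE}_{FO}$ the query $?x_1\dots?x_{\ell-1}!a\,\varphi(T)(x_1,\dots,x_{\ell-1},a)$,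 with atoms of $T$ decided at their holding node from the current table. - Whenever a tuple $(a,a_2,\dots,a_\ell)$ is found to satisfy $\varphi(T)$, it is put in a temporary buffer at $a$. - When $\tau$ expires, $a$ adds the buffered tuples to its table for $T$ and sets a clock $\eta=\Delta$. If new tuples were added, $a$ floods an informing message to all nodes. - When $\eta$ expires, a node that produced new tuples or received an informing message starts the next stage; otherwise the evaluation terminates.
   Formalization: The clocks use the number of variables and constants counted with multiplicity (each occurrence in an atom, each quantified variable, and for w each listed variable); with distinct symbols the claim fails, e.g. on a star for ∀x∃y(¬G(x,y)∧¬x=y). *)

(* Defs.v *)
From HB Require Import structures.
From mathcomp Require Import all_boot all_order finmap.

Set Implicit Arguments.
Unset Strict Implicit.
Unset Printing Implicit Defensive.

Local Open Scope fset_scope.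

(** * Networks *)

Definition infinite_type (U : eqType) : Prop :=
  forall s : seq U, exists x : U, x \notin s.

Record network (disp : Order.disp_t) (U : orderType disp) (D : nat) := Network {
  nodes : {fset U};
  edge : rel U;
  nodes_neq0 : nodes != fset0;
  edge_nodes : forall u v, edge u v -> (u \in nodes) && (v \in nodes);
  edge_sym : symmetric edge;
  edge_connected :
    {in nodes &, forall u v, exists2 p, path edge u p & last u p = v};
  edge_degree : {in nodes, forall u, #|` [fset v in nodes | edge u v]| <= D}
}.

Section Distance.

Variables (U : eqType) (V : seq U) (E : rel U).

Fixpoint walk (k : nat) (u v : U) : bool :=
  if k is k'.+1 then (u == v) || has (fun z => E u z && walk k' z v) V
  else u == v.

(* In a connected graph the distances are at most [(size V).-1]. *)
Definition dist (u v : U) : nat := find (fun k => walk k u v) (iota 0 (size V)).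

Definition diam : nat := \max_(u <- V) \max_(v <- V) dist u v.

End Distance.

(** * First-order formulas over G and T *)

Inductive term (U : Type) := Var of nat | Cst of U.
Arguments Var {U}.

Inductive quant := Ex | All.

Definition quant_flip (Q : quant) : quant := if Q is Ex then All else Ex.

(* [T] has arity [l.+1]: a tuple of [T] is stored at the node named by its
   first component, so arity 0 makes no sense for the engine. *)
Inductive formula (U : Type) (l : nat) :=
| FBool of bool
| FG of term U & term U
| FT of l.+1.-tuple (term U)
| FEq of term U & term U
| FNot of formula U l
| FAnd of formula U l & formula U l
| FOr of formula U l & formula U l
| FQ of quant & nat & formula U l.
Arguments FBool {U l}.
Arguments FG {U l}.
Arguments FEq {U l}.

Section EqTypes.

Variables (U : eqType) (l : nat).

Definition term_code (t : term U) : nat + U :=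
  match t with Var x => inl x | Cst a => inr a end.
Definition term_decode (s : nat + U) : term U :=
  match s with inl x => Var x | inr a => Cst a end.
Lemma term_codeK : cancel term_code term_decode. Proof. by case. Qed.
HB.instance Definition _ := Equality.copy (term U) (can_type term_codeK).

Definition quant_code (Q : quant) : bool := if Q is Ex then true else false.
Definition quant_decode (b : bool) : quant := if b then Ex else All.
Lemma quant_codeK : cancel quant_code quant_decode. Proof. by case. Qed.
HB.instance Definition _ := Equality.copy quant (can_type quant_codeK).

Fixpoint formula_eqb (p q : formula U l) : bool :=
  match p, q with
  | FBool b, FBool c => b == c
  | FG s t, FG s' t' => (s == s') && (t == t')
  | FT ts, FT ts' => ts == ts'
  | FEq s t, FEq s' t' => (s == s') && (t == t')
  | FNot p1, FNot q1 => formula_eqb p1 q1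
  | FAnd p1 p2, FAnd q1 q2 => formula_eqb p1 q1 && formula_eqb p2 q2
  | FOr p1 p2, FOr q1 q2 => formula_eqb p1 q1 && formula_eqb p2 q2
  | FQ Q x p1, FQ Q' x' q1 => [&& Q == Q', x == x' & formula_eqb p1 q1]
  | _, _ => false
  end.

Lemma formula_eqP : Equality.axiom formula_eqb.
Proof.
move=> p q; apply: (iffP idP) => [|<-]; last first.
  elim: p {q} => //= [s t|s t|p -> q ->|p -> q ->|Q x p ->] //; by rewrite !eqxx.
elim: p q => [b|s t|ts|s t|p IH|p IH1 q IH2|p IH1 q IH2|Q x p IH] [] //=.
- by move=> c /eqP ->.
- by move=> s' t' /andP[/eqP -> /eqP ->].
- by move=> ts' /eqP ->.
- by move=> s' t' /andP[/eqP -> /eqP ->].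
- by move=> p' /IH ->.
- by move=> p' q' /andP[/IH1 -> /IH2 ->].
- by move=> p' q' /andP[/IH1 -> /IH2 ->].
- by move=> Q' x' p' /and3P[/eqP -> /eqP -> /IH ->].
Qed.
HB.instance Definition _ := hasDecEq.Build (formula U l) formula_eqP.

End EqTypes.

Section Formulas.

Variables (U : eqType) (l : nat).
Notation term := (term U).
Notation formula := (formula U l).

Definition term_vars (t : term) : seq nat := if t is Var x then [:: x] else [::].
Definition term_consts (t : term) : seq U := if t is Cst a then [:: a] else [::].

Fixpoint free_vars (p : formula) : seq nat :=
  match p with
  | FBool _ => [::]
  | FG s t | FEq s t => term_vars s ++ term_vars t
  | FT ts => flatten [seq term_vars t | t <- ts]
  | FNot p => free_vars p
  | FAnd p q | FOr p q => free_vars p ++ free_vars q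
  | FQ _ x p => [seq y <- free_vars p | y != x]
  end.

Fixpoint consts (p : formula) : seq U :=
  match p with
  | FBool _ => [::]
  | FG s t | FEq s t => term_consts s ++ term_consts t
  | FT ts => flatten [seq term_consts t | t <- ts]
  | FNot p => consts p
  | FAnd p q | FOr p q => consts p ++ consts q
  | FQ _ _ p => consts p
  end.

(* The number of variables and constants, counted with multiplicity: every
   occurrence in an atom and every quantified variable counts for one.  With
   this count instantiating a quantifier decreases the number by one, so the
   clock of a subquery is shorter by at least two diameters than the clock of
   its parent.  Counting distinct symbols instead would leave the number
   unchanged when a variable is replaced by an identifier. *)
Fixpoint nb_symbols (p : formula) : nat :=
  match p with
  | FBool _ => 0
  | FG _ _ | FEq _ _ => 2
  | FT _ => l.+1
  | FNot p => nb_symbols p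
  | FAnd p q | FOr p q => nb_symbols p + nb_symbols q
  | FQ _ _ p => (nb_symbols p).+1
  end.

Fixpoint formula_size (p : formula) : nat :=
  match p with
  | FNot p | FQ _ _ p => (formula_size p).+1
  | FAnd p q | FOr p q => (formula_size p + formula_size q).+1
  | _ => 1
  end.

Definition term_subst (x : nat) (a : U) (t : term) : term :=
  if t is Var y then if y == x then Cst a else t else t.

Fixpoint subst (x : nat) (a : U) (p : formula) : formula :=
  match p with
  | FBool b => FBool b
  | FG s t => FG (term_subst x a s) (term_subst x a t)
  | FT ts => FT [tuple of map (term_subst x a) ts]
  | FEq s t => FEq (term_subst x a s) (term_subst x a t)
  | FNot p => FNot (subst x a p)
  | FAnd p q => FAnd (subst x a p) (subst x a q)
  | FOr p q => FOr (subst x a p) (subst x a q)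
  | FQ Q y p => if y == x then FQ Q y p else FQ Q y (subst x a p)
  end.

(** ** Prenex normal form *)

Definition term_rename (r : nat -> nat) (t : term) : term :=
  if t is Var x then Var (r x) else t.

(* [prenex_rec r k p] is the prefix and the matrix of [p] with its free
   variables renamed by [r] and its bound variables renamed to [k], [k.+1],
   ...; the last component is the next unused name. *)
Fixpoint prenex_rec (r : nat -> nat) (k : nat) (p : formula) :
    seq (quant * nat) * formula * nat :=
  match p with
  | FBool b => ([::], FBool b, k)
  | FG s t => ([::], FG (term_rename r s) (term_rename r t), k)
  | FT ts => ([::], FT [tuple of map (term_rename r) ts], k)
  | FEq s t => ([::], FEq (term_rename r s) (term_rename r t), k)
  | FNot p =>
      let: (pre, m, k1) := prenex_rec r k p in
      ([seq (quant_flip Qx.1, Qx.2) | Qx <- pre], FNot m, k1)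
  | FAnd p q =>
      let: (pre1, m1, k1) := prenex_rec r k p in
      let: (pre2, m2, k2) := prenex_rec r k1 q in
      (pre1 ++ pre2, FAnd m1 m2, k2)
  | FOr p q =>
      let: (pre1, m1, k1) := prenex_rec r k p in
      let: (pre2, m2, k2) := prenex_rec r k1 q in
      (pre1 ++ pre2, FOr m1 m2, k2)
  | FQ Q x p =>
      let: (pre, m, k1) :=
        prenex_rec (fun y => if y == x then k else r y) k.+1 p in
      ((Q, k) :: pre, m, k1)
  end.

(* [xs] must contain the free variables of [p]. *)
Definition prenex (xs : seq nat) (p : formula) : formula :=
  let: (pre, m, _) := prenex_rec id (\max_(x <- xs) x).+1 p in
  foldr (fun Qx q => FQ Qx.1 Qx.2 q) m pre.

(** ** Semantics of formulas and fixpoint formulas *)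

Record fpformula := FPFormula {
  fp_vars : l.+1.-tuple nat;
  fp_body : formula;
  fp_vars_uniq : uniq fp_vars;
  fp_vars_free : {subset free_vars fp_body <= fp_vars}
}.

Definition term_val (e : nat -> U) (t : term) : U :=
  match t with Var x => e x | Cst a => a end.

Fixpoint sat (V : seq U) (E : rel U) (I : pred (l.+1.-tuple U))
    (e : nat -> U) (p : formula) : bool :=
  match p with
  | FBool b => b
  | FG s t => E (term_val e s) (term_val e t)
  | FT ts => I [tuple of map (term_val e) ts]
  | FEq s t => term_val e s == term_val e t
  | FNot p => ~~ sat V E I e p
  | FAnd p q => sat V E I e p && sat V E I e q
  | FOr p q => sat V E I e p || sat V E I e q
  | FQ Ex x p => has (fun a => sat V E I (fun y => if y == x then a else e y) p) V
  | FQ All x p => all (fun a => sat V E I (fun y => if y == x then a else e y) p) V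
  end.

Definition assign (xs : l.+1.-tuple nat) (a : l.+1.-tuple U) (x : nat) : U :=
  nth (thead a) a (index x xs).

Definition fp_op (V : seq U) (E : rel U) (F : fpformula)
    (I : pred (l.+1.-tuple U)) : pred (l.+1.-tuple U) :=
  fun a => all (mem V) a && sat V E I (assign (fp_vars F) a) (fp_body F).

Fixpoint fp_stage (V : seq U) (E : rel U) (F : fpformula) (i : nat) :
    pred (l.+1.-tuple U) :=
  if i is i'.+1 then
    fun a => fp_op V E F (fp_stage V E F i') a || fp_stage V E F i' a
  else pred0.

End Formulas.

(** * The query engines *)

Section Engine.

Variables (U : eqType) (l : nat).
Notation formula := (formula U l).
Notation fpformula := (fpformula U l).

(* [QOpen [:: x_1; ...; x_i] [:: a_(i+1); ...; a_l] p] is the partially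
   instantiated query, where [p] has the [a_j] already substituted. *)
Inductive query :=
| QOpen of seq nat & seq U & formula
| QBool of formula.

Definition query_code (q : query) : (seq nat * seq U * formula) + formula :=
  match q with QOpen xs cs p => inl (xs, cs, p) | QBool p => inr p end.
Definition query_decode (c : (seq nat * seq U * formula) + formula) : query :=
  match c with inl (xs, cs, p) => QOpen xs cs p | inr p => QBool p end.
Lemma query_codeK : cancel query_code query_decode. Proof. by case. Qed.
HB.instance Definition _ := Equality.copy query (can_type query_codeK).

Inductive message :=
| MFix of fpformula & nat
| MQuery of query
| MAnswer of formula & bool
| MInform.

(* All that a node knows about the network. *)
Record local_info := LocalInfo {
  self : U;
  neighbours : seq U;
  net_size : nat;
  net_diam : nat
}.

Definition table := seq (seq U).

(** ** The first-order engine at one node *)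

(* In [fo_queries] the parent is [None] for a query received from a neighbour
   or posed initially.  [fo_clocks] lists the Boolean queries the node waits
   for, the most recent first, with the rounds left.  [fo_buffer] holds the
   tuples found, and [fo_out] the messages to broadcast in this round. *)
Record fo_state := FOState {
  fo_queries : seq (query * option query);
  fo_answers : seq (formula * bool);
  fo_clocks : seq (formula * nat);
  fo_buffer : table;
  fo_out : seq message
}.

Definition fo_init : fo_state := FOState [::] [::] [::] [::] [::].

Definition fo_send (m : message) (s : fo_state) : fo_state :=
  FOState (fo_queries s) (fo_answers s) (fo_clocks s) (fo_buffer s)
          (rcons (fo_out s) m).

Definition fo_store (cs : seq U) (s : fo_state) : fo_state :=
  if cs \in fo_buffer s then s else
  FOState (fo_queries s) (fo_answers s) (fo_clocks s) (cs :: fo_buffer s)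
          (fo_out s).

Definition fo_answer (s : fo_state) (p : formula) : option bool :=
  if p is FBool b then Some b
  else ohead [seq e.2 | e <- fo_answers s & e.1 == p].

Definition fo_learn (p : formula) (b : bool) (s : fo_state) : fo_state :=
  if fo_answer s p is Some _ then s else
  fo_send (MAnswer p b)
    (FOState (fo_queries s) ((p, b) :: fo_answers s) (fo_clocks s) (fo_buffer s)
             (fo_out s)).

Definition fo_record (e : query * option query) (s : fo_state) : fo_state :=
  if e \in fo_queries s then s else
  FOState (e :: fo_queries s) (fo_answers s) (fo_clocks s) (fo_buffer s)
          (fo_out s).

Definition fo_set_clock (p : formula) (c : nat) (s : fo_state) : fo_state :=
  if p \in unzip1 (fo_clocks s) then s else
  FOState (fo_queries s) (fo_answers s) ((p, c) :: fo_clocks s) (fo_buffer s)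
          (fo_out s).

Section LocalComputation.

Variables (i : local_info) (tbl : table).

Fixpoint simplify (p : formula) : formula :=
  match p with
  | FG (Cst a) (Cst b) =>
      if a == self i then FBool (b \in neighbours i)
      else if b == self i then FBool (a \in neighbours i)
      else p
  | FEq (Cst a) (Cst b) => FBool (a == b)
  | FT ts =>
      let cs := flatten [seq term_consts t | t <- ts] in
      if (size cs == l.+1) && (ohead cs == Some (self i))
      then FBool (cs \in tbl) else p
  | FNot p =>
      match simplify p with
      | FBool b => FBool (~~ b)
      | p' => FNot p'
      end
  | FAnd p q =>
      match simplify p, simplify q with
      | FBool b, q' => if b then q' else FBool false
      | p', FBool b => if b then p' else FBool false
      | p', q' => FAnd p' q'
      end
  | FOr p q =>
      match simplify p, simplify q with
      | FBool b, q' => if b then FBool true else q'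
      | p', FBool b => if b then FBool true else p'
      | p', q' => FOr p' q'
      end
  | FQ Q x p => FQ Q x (simplify p)
  | _ => p
  end.

Definition is_truth_value (q : query) : bool :=
  if q is QBool (FBool _) then true else false.

(* The subquery that the node derives from a query it handles, if any.  A
   quantifier-free Boolean query is passed on after local simplification, if
   the node can decide some of its atoms. *)
Definition derive (q : query) : option query :=
  match q with
  | QOpen (x :: xs) cs p =>
      let y := last x xs in
      Some (QOpen (belast x xs) (self i :: cs) (simplify (subst y (self i) p)))
  | QOpen [::] cs p => if ohead cs == Some (self i) then Some (QBool p) else None
  | QBool (FQ _ x p) => Some (QBool (simplify (subst x (self i) p)))
  | QBool p => if simplify p == p then None else Some (QBool (simplify p))
  end.

(* The clock of a node that waits for the answer to a quantified query. *)
Definition wait_for (q : query) (s : fo_state) : fo_state :=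
  if q is QBool (FQ _ _ _ as p)
  then fo_set_clock p (2 * net_diam i * nb_symbols p) s else s.

(* A node poses a subquery of its own ([parent] is the query it comes from) or
   takes over a query received from a neighbour ([parent] is [None]).  Only a
   query that is not yet in the query table is broadcast and handled.  [k]
   bounds the number of successive derivations, see [query_depth]. *)
Fixpoint fo_pose (k : nat) (q : query) (parent : option query) (s : fo_state) :
    fo_state :=
  let known := q \in unzip1 (fo_queries s) in
  let s1 := fo_record (q, parent) s in
  let s2 := if parent is Some _ then wait_for q s1 else s1 in
  if known || is_truth_value q then s2 else
  let s3 := fo_send (MQuery q) s2 in
  if k is k'.+1 then
    if derive q is Some q' then fo_pose k' q' (Some q) s3 else s3
  else s3.

Definition query_depth (q : query) : nat :=
  match q with
  | QOpen xs _ p => size xs + formula_size p + 3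
  | QBool p => formula_size p + 3
  end.

Definition fo_conclude (s : fo_state) (e : query * option query) : fo_state :=
  match e with
  | (QBool p, Some parent) =>
      if fo_answer s p is Some b then
        match parent with
        | QBool (FQ Ex _ _ as r) => if b then fo_learn r true s else s
        | QBool (FQ All _ _ as r) => if b then s else fo_learn r false s
        | QBool r => fo_learn r b s
        | QOpen _ cs _ => if b then fo_store cs s else s
        end
      else s
  | _ => s
  end.

(* A chain of successive parents is no longer than the query table. *)
Definition fo_saturate (s : fo_state) : fo_state :=
  iter (size (fo_queries s)) (fun s' => foldl fo_conclude s' (fo_queries s')) s.

Definition fo_receive (s : fo_state) (m : message) : fo_state :=
  match m with
  | MQuery q => fo_pose (query_depth q) q None s
  | MAnswer p b => fo_learn p b s
  | _ => s
  end.

(* No effect if the answer is already known. *)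
Definition fo_expire (s : fo_state) (p : formula) : fo_state :=
  match p with
  | FQ Ex _ _ => fo_saturate (fo_learn p false s)
  | FQ All _ _ => fo_saturate (fo_learn p true s)
  | _ => s
  end.

(* One round.  The messages received are treated before the clocks that expire
   in this round, and these are treated the most recent first; the latter only
   matters for a one-node network, where all clocks are 0. *)
Definition fo_round (inbox : seq message) (s : fo_state) : fo_state :=
  let s0 := FOState (fo_queries s) (fo_answers s)
              [seq (e.1, e.2.-1) | e <- fo_clocks s] (fo_buffer s) [::] in
  let s1 := fo_saturate (foldl fo_receive s0 inbox) in
  let s2 := foldl fo_expire s1 [seq e.1 | e <- fo_clocks s1 & e.2 == 0] in
  FOState (fo_queries s2) (fo_answers s2)
          [seq e <- fo_clocks s2 | e.2 != 0] (fo_buffer s2) (fo_out s2).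

(* The query [?x_1 ... ?x_(l-1) !a p] for the node [a]. *)
Definition fo_start (F : fpformula) : fo_state :=
  let xs := fp_vars F in
  let p := prenex xs (fp_body F) in
  let y := last (thead xs) (behead xs) in
  let q := QOpen (belast (thead xs) (behead xs)) [:: self i]
                 (simplify (subst y (self i) p)) in
  fo_saturate (fo_pose (query_depth q) q None fo_init).

End LocalComputation.

(** ** The fixpoint engine at one node *)

Inductive node_state :=
| Idle
| Flooding of fpformula & nat
| Evaluating of fpformula & table & nat & fo_state
| Informing of fpformula & table & nat & bool
| Halted of table.

Definition halted (s : node_state) : bool := if s is Halted _ then true else false.

Definition local_table (s : node_state) : table :=
  match s with
  | Evaluating _ tbl _ _ | Informing _ tbl _ _ | Halted tbl => tbl
  | _ => [::]
  end.

(* The listed variables [x_1, ..., x_l] count as well. *)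
Definition fp_nb_symbols (F : fpformula) : nat := l.+1 + nb_symbols (fp_body F).

Definition start_stage (i : local_info) (F : fpformula) (tbl : table) :
    node_state * seq message :=
  let s := fo_start i tbl F in
  (Evaluating F tbl (2 * net_diam i * fp_nb_symbols F) s, fo_out s).

Definition is_inform (m : message) : bool := if m is MInform then true else false.

Definition first_fix (inbox : seq message) : option (fpformula * nat) :=
  ohead (pmap (fun m => if m is MFix F c then Some (F, c) else None) inbox).

(* One round of a node: the new state, and the messages broadcast to all the
   neighbours.  A clock set to [c] in round [t] expires in round [t + c], after
   the messages received have been treated; at most one of the clocks sigma,
   tau, eta is treated in a round, so for a one-node network the clocks tau and
   eta, which are 0, expire one round after they are set. *)
Definition node_step (i : local_info) (s : node_state) (inbox : seq message) :
    node_state * seq message :=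
  match s with
  | Idle =>
      if first_fix inbox is Some (F, c) then
        if c is c'.+1 then (Flooding F c, [:: MFix F c'])
        else start_stage i F [::]
      else (Idle, [::])
  | Flooding F sigma =>
      if sigma.-1 == 0 then start_stage i F [::]
      else (Flooding F sigma.-1, [::])
  | Evaluating F tbl tau fo =>
      let fo' := fo_round i tbl inbox fo in
      if tau.-1 == 0 then
        let new := [seq cs <- fo_buffer fo' | cs \notin tbl] in
        (Informing F (new ++ tbl) (net_diam i) (new != [::]),
         fo_out fo' ++ (if new != [::] then [:: MInform] else [::]))
      else (Evaluating F tbl tau.-1 fo', fo_out fo')
  | Informing F tbl eta informed =>
      let received := has is_inform inbox in
      let out := if received && ~~ informed then [:: MInform] else [::] in
      if eta.-1 == 0 then
        if informed || received then
          let: (s', out') := start_stage i F tbl in (s', out ++ out')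
        else (Halted tbl, out)
      else (Informing F tbl eta.-1 (informed || received), out)
  | Halted tbl => (Halted tbl, [::])
  end.

(** ** Synchronous runs *)

Section Run.

Variables (V : seq U) (E : rel U).

Definition info_of (v : U) : local_info :=
  LocalInfo v [seq u <- V | E v u] (size V) (diam V E).

(* [run F r t v] is the state of [v] after round [t] together with the messages
   it broadcasts in that round, when [r] requests the fixpoint of [F].  The
   request amounts to handing the message [(F, diameter)] to [r]. *)
Fixpoint run (F : fpformula) (r : U) (t : nat) (v : U) :
    node_state * seq message :=
  if t is t'.+1 then
    node_step (info_of v) (run F r t' v).1
      (flatten [seq (run F r t' u).2 | u <- V & E u v])
  else
    node_step (info_of v) Idle
      (if v == r then [:: MFix F (diam V E)] else [::]).

Definition produces (F : fpformula) (r : U) (I : l.+1.-tuple U -> Prop) : Prop :=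
  exists t : nat,
    {in V, forall v, halted (run F r t v).1} /\
    forall a : l.+1.-tuple U,
      I a <-> exists2 v, v \in V & tval a \in local_table (run F r t v).1.

End Run.

End Engine.

(** * Satisfaction and distributed evaluation over a network *)

Section Networks.

Variables (disp : Order.disp_t) (U : orderType disp) (D l : nat).
Variables (N : network U D) (F : fpformula U l) (I : l.+1.-tuple U -> Prop).

Let V := enum_fset (nodes N).

(* G, I |= mu(F) *)
Definition fp_models : Prop :=
  exists i : nat,
    fp_stage V (edge N) F i.+1 =1 fp_stage V (edge N) F i /\
    forall a, I a <-> fp_stage V (edge N) F i a.

(* G, I |-_FP mu(F) *)
Definition fp_derives : Prop :=
  {in nodes N, forall r, produces V (edge N) F r I}.

End Networks.

(* Main.v *)
Require Import Defs.
From mathcomp Require Import all_boot all_order finmap.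
From mathcomp Require Import zify.

Set Implicit Arguments.
Unset Strict Implicit.
Unset Printing Implicit Defensive.

(* All nodes run in lockstep: flooding takes as many rounds as the diameter, so
   the stages start and end everywhere in the same rounds, and it suffices that
   one stage computes [fp_op] of the current tables.

   A query known to some node in round [t] is known to all nodes in round
   [t + Delta], and so are answers.  By induction on the number of symbols, if a
   quantified query [p] known to a node in round [t] has a witness (or a
   counterevidence), then some node settles the instance of [p] by its own
   identifier within [2 * Delta * nb_symbols p - Delta] rounds, and the answer
   is everywhere [Delta] rounds later, that is, not after the clock expires.
   Hence, by induction on the round, a default answer is never wrong.  A
   quantifier-free query is settled in time because the node named by a constant
   of any atom simplifies it further.  In a one-node network all clocks are 0,
   and the argument rests instead on the order in which they expire. *)

(** The obstacle is a circularity. A default answer is right only if all evidence arrives before the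
    clock expires, which is a matter of completeness; evidence is right only if the answers below
    it, defaults included, are. Time breaks the circle: evidence that arrives at the deadline was
    found [Delta] rounds earlier, so for positive [Delta] soundness in earlier rounds suffices. A
    message that comes in exactly at the deadline must still count, hence the separate name for the
    state inside a round after the inbox is read and before clocks expire. Of the two diameters per
    symbol, one carries a query to a node that can work on it and one brings the answer back. Prenex
    form and the propagation of truth values leave only quantified formulas, truth values and
    combinations of genuine atoms, so some node can always make progress. The listed variables are
    paid for by the summand [l.+1] of [fp_nb_symbols]: instantiating a tuple from right to left
    takes at most [l * Delta] rounds. *)

Section Formulas.

(** * Formulas: substitution, shapes of circulating queries, local simplification *)

Variables (U : eqType) (l : nat).
Notation formula := (formula U l).
Implicit Types (p q : formula) (e : nat -> U) (x y : nat) (a : U).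

Definition upd e x a : nat -> U := fun y => if y == x then a else e y.

Section Semantics.

Variables (V : seq U) (E : rel U) (J : pred (l.+1.-tuple U)).
Notation sat := (sat V E J).

Lemma sat_ext e e' p : {in free_vars p, e =1 e'} -> sat e p = sat e' p.
Proof.
have term_val_ext (d d' : nat -> U) t :
    {in term_vars t, d =1 d'} -> term_val d t = term_val d' t.
  by case: t => //= x; apply; rewrite inE.
elim: p e e' => //= [s t|ts|s t|p IH|p IHp q IHq|p IHp q IHq|Q x p IH] e e' H.
- by congr (E _ _); apply: term_val_ext => x Hx; apply: H; rewrite mem_cat Hx ?orbT.
- congr (J _); apply: val_inj => /=; apply/eq_in_map => t Ht; apply: term_val_ext.
  by move=> x Hx; apply: H; apply/flattenP; exists (term_vars t) => //; apply: map_f.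
- by congr (_ == _); apply: term_val_ext => x Hx; apply: H; rewrite mem_cat Hx ?orbT.
- by rewrite (IH e e').
- by rewrite (IHp e e') ?(IHq e e') // => x Hx; apply: H; rewrite mem_cat Hx ?orbT.
- by rewrite (IHp e e') ?(IHq e e') // => x Hx; apply: H; rewrite mem_cat Hx ?orbT.
- have Hu a : sat (fun y => if y == x then a else e y) p =
              sat (fun y => if y == x then a else e' y) p.
    apply: IH => y Hy; case: eqVneq => // yx; apply: H.
    by rewrite mem_filter yx.
  by case: Q; [apply: eq_has|apply: eq_all].
Qed.

Lemma sat_subst e x a p : sat e (subst x a p) = sat (upd e x a) p.
Proof.
have term_val_subst d t : term_val d (term_subst x a t) = term_val (upd d x a) t.
  by case: t => //= y; rewrite /upd; case: eqP.
elim: p e => //= [s t|ts|s t|p IH|p IHp q IHq|p IHp q IHq|Q y p IH] e.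
- by rewrite !term_val_subst.
- congr (J _); apply: val_inj => /=; rewrite -map_comp; apply: eq_map => t /=.
  exact: term_val_subst.
- by rewrite !term_val_subst.
- by rewrite IH.
- by rewrite IHp IHq.
- by rewrite IHp IHq.
- case: eqP => [->|yx] /=.
    have Hu b : sat (fun y => if y == x then b else e y) p =
                sat (fun y => if y == x then b else upd e x a y) p.
      by apply: sat_ext => z _; rewrite /upd; case: eqP.
    by case: Q; [apply: eq_has|apply: eq_all].
  have Hu b : sat (fun z => if z == y then b else e z) (subst x a p) =
              sat (fun z => if z == y then b else upd e x a z) p.
    rewrite IH; apply: sat_ext => z _; rewrite /upd.
    by case: (eqVneq z x) => // ->; case: eqP yx => // ->.
  by case: Q; [apply: eq_has|apply: eq_all].
Qed.

End Semantics.

Fixpoint quantifier_free p : bool :=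
  match p with
  | FNot p => quantifier_free p
  | FAnd p q | FOr p q => quantifier_free p && quantifier_free q
  | FQ _ _ _ => false
  | _ => true
  end.

Fixpoint is_prenex p : bool :=
  if p is FQ _ _ p then is_prenex p else quantifier_free p.

(** Truth values are excluded, unlike in [quantifier_free]: a closed formula of this shape contains
    an atom over constants, so some node can simplify it. *)
Fixpoint atoms_only p : bool :=
  match p with
  | FNot p => atoms_only p
  | FAnd p q | FOr p q => atoms_only p && atoms_only q
  | FBool _ | FQ _ _ _ => false
  | _ => true
  end.

(* The shape of the formulas of all queries that circulate. *)
Fixpoint reduced p : bool :=
  match p with
  | FQ _ _ p => reduced p
  | FBool _ => true
  | _ => atoms_only p
  end.

Lemma atoms_only_qf p : atoms_only p -> quantifier_free p.
Proof.
by elim: p => //= p IHp q IHq /andP[/IHp -> /IHq ->].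
Qed.

Lemma reduced_prenex p : reduced p -> is_prenex p.
Proof.
by elim: p => //= [p _|p _ q _|p _ q _]; [exact: atoms_only_qf| |];
  case/andP => /atoms_only_qf -> /atoms_only_qf.
Qed.

Lemma is_prenex_subst x a p : is_prenex (subst x a p) = is_prenex p.
Proof.
have qfS q : quantifier_free (subst x a q) = quantifier_free q.
  by elim: q => //= [q -> r ->|q -> r ->|Q y q _] //; case: eqP.
elim: p => //= [p _ q _|p _ q _|Q y p IH]; rewrite ?qfS //.
by case: eqP.
Qed.

Lemma nb_symbols_subst x a p : nb_symbols (subst x a p) = nb_symbols p.
Proof.
by elim: p => //= [p -> q ->|p -> q ->|Q y p IH] //; case: eqP => //= _; rewrite IH.
Qed.

Lemma free_vars_subst x a p :
  free_vars (subst x a p) = [seq y <- free_vars p | y != x].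
Proof.
have tvS t : term_vars (term_subst x a t) = [seq y <- term_vars t | y != x].
  by case: t => //= y; case: eqP => //= /eqP ->.
elim: p => //= [s t|ts|s t|p IHp q IHq|p IHp q IHq|Q y p IH].
- by rewrite filter_cat !tvS.
- elim: (tval ts) => //= t s ->; by rewrite filter_cat tvS.
- by rewrite filter_cat !tvS.
- by rewrite filter_cat IHp IHq.
- by rewrite filter_cat IHp IHq.
- case: (eqVneq y x) => [->|yx] /=.
    by rewrite -filter_predI; apply: eq_filter => z /=; rewrite andbb.
  by rewrite IH -!filter_predI; apply: eq_filter => z /=; rewrite andbC.
Qed.

Lemma consts_subst x a p : {subset consts (subst x a p) <= a :: consts p}.
Proof.
have tcS t : {subset term_consts (term_subst x a t) <= a :: term_consts t}.
  by case: t => //= [y|b] c; [case: eqP => //= _|]; rewrite ?inE // => ->; rewrite ?orbT.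
have cat2 (A B A' B' : seq U) : {subset A <= a :: A'} -> {subset B <= a :: B'} ->
    {subset A ++ B <= a :: A' ++ B'}.
  move=> HA HB c; rewrite mem_cat inE mem_cat => /orP[/HA|/HB];
    by rewrite inE => /orP[->|->]; rewrite ?orbT.
elim: p => //= [s t|ts|s t|p IHp q IHq|p IHp q IHq|Q y p IH].
- exact: cat2.
- by elim: (tval ts) => //= t s IH; apply: cat2.
- exact: cat2.
- exact: cat2.
- exact: cat2.
- by case: eqP => //= _ c; rewrite inE => ->; rewrite orbT.
Qed.

(** [formula_size] does not drop when an atom becomes a truth value, since both have size 1. Giving
    truth values weight 0 turns every effective simplification into a strict decrease, which bounds
    the chains of derivations. *)
Fixpoint weight p : nat :=
  match p with
  | FBool _ => 0
  | FNot p | FQ _ _ p => (weight p).+1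
  | FAnd p q | FOr p q => (weight p + weight q).+1
  | _ => 1
  end.

Lemma weight_size p : weight p <= formula_size p.
Proof. by elim: p => //= p IHp q IHq; rewrite ltnS leq_add. Qed.

Lemma weight_subst x a p : weight (subst x a p) = weight p.
Proof.
by elim: p => //= [p ->|p -> q ->|p -> q ->|Q y p IH] //; case: eqP => //= _; rewrite IH.
Qed.

Section Simplify.

Variables (i : local_info U) (tbl : table U).
Notation simplify := (simplify i tbl).

(** The nested matches on the two simplified operands have dozens of branches; these are their only
    five outcomes. *)
Variant and_spec p q : formula -> Type :=
| AndL of simplify p = FBool true : and_spec p q (simplify q)
| AndR of simplify q = FBool true : and_spec p q (simplify p)
| AndFl of simplify p = FBool false : and_spec p q (FBool false)
| AndFr of simplify q = FBool false : and_spec p q (FBool false)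
| AndN of (forall b, simplify p <> FBool b) & (forall b, simplify q <> FBool b) :
    and_spec p q (FAnd (simplify p) (simplify q)).

Lemma simplify_andP p q : and_spec p q (simplify (FAnd p q)).
Proof.
rewrite /=; case Hp: (simplify p) => [[]|s t|ts|s t|p'|p1 p2|p1 p2|Q x p'] /=;
  try solve [exact: AndL | exact: AndFl];
  case Hq: (simplify q) => [[]|s' t'|ts'|s' t'|q'|q1 q2|q1 q2|Q' x' q'] /=;
  rewrite -?Hp; try solve [exact: AndR | exact: AndFr];
  rewrite -?Hq; by apply: AndN => b; rewrite ?Hp ?Hq.
Qed.

Variant or_spec p q : formula -> Type :=
| OrL of simplify p = FBool false : or_spec p q (simplify q)
| OrR of simplify q = FBool false : or_spec p q (simplify p)
| OrTl of simplify p = FBool true : or_spec p q (FBool true)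
| OrTr of simplify q = FBool true : or_spec p q (FBool true)
| OrN of (forall b, simplify p <> FBool b) & (forall b, simplify q <> FBool b) :
    or_spec p q (FOr (simplify p) (simplify q)).

Lemma simplify_orP p q : or_spec p q (simplify (FOr p q)).
Proof.
rewrite /=; case Hp: (simplify p) => [[]|s t|ts|s t|p'|p1 p2|p1 p2|Q x p'] /=;
  try solve [exact: OrL | exact: OrTl];
  case Hq: (simplify q) => [[]|s' t'|ts'|s' t'|q'|q1 q2|q1 q2|Q' x' q'] /=;
  rewrite -?Hp; try solve [exact: OrR | exact: OrTr];
  rewrite -?Hq; by apply: OrN => b; rewrite ?Hp ?Hq.
Qed.

Variant not_spec p : formula -> Type :=
| NotB b of simplify p = FBool b : not_spec p (FBool (~~ b))
| NotN of (forall b, simplify p <> FBool b) : not_spec p (FNot (simplify p)).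

Lemma simplify_notP p : not_spec p (simplify (FNot p)).
Proof.
rewrite /=; case Hp: (simplify p) => [b|s t|ts|s t|p'|p1 p2|p1 p2|Q x p'];
  rewrite /= -?Hp; try by constructor.
all: by apply: NotN => b; rewrite ?Hp.
Qed.

Variant atom_spec p : formula -> Type :=
| AtomB b : atom_spec p (FBool b)
| AtomN : atom_spec p p.

Lemma simplify_GP s t : atom_spec (FG s t) (simplify (FG s t)).
Proof.
by case: s t => [x|a] [y|b] /=; try constructor; case: ifP => _;
  [|case: ifP => _]; constructor.
Qed.

Lemma simplify_EqP s t : atom_spec (FEq s t) (simplify (FEq s t)).
Proof. by case: s t => [x|a] [y|b]; constructor. Qed.

Lemma simplify_TP ts : atom_spec (FT ts) (simplify (FT ts)).
Proof. by rewrite /=; case: ifP => _; constructor. Qed.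

Lemma reduced_not_bool p : (forall b, p <> FBool b) -> quantifier_free p ->
  reduced p -> atoms_only p.
Proof. by case: p => //= b /(_ b). Qed.

Lemma quantifier_free_simplify p : quantifier_free p ->
  quantifier_free (simplify p) && reduced (simplify p).
Proof.
elim: p => [b|s t|ts|s t|p IH|p IHp q IHq|p IHp q IHq|//].
- by [].
- by case: simplify_GP.
- by case: simplify_TP.
- by case: simplify_EqP.
- move=> /IH /andP[qp rp]; case: simplify_notP => //= nb.
  by rewrite qp reduced_not_bool.
- move=> /andP[/IHp/andP[qp rp] /IHq/andP[qq rq]].
  case: simplify_andP => // [_|_|np nq]; rewrite ?qp ?qq //=.
  by rewrite qp qq !reduced_not_bool.
- move=> /andP[/IHp/andP[qp rp] /IHq/andP[qq rq]].
  case: simplify_orP => // [_|_|np nq]; rewrite ?qp ?qq //=.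
  by rewrite qp qq !reduced_not_bool.
Qed.

Lemma reduced_simplify p : is_prenex p -> reduced (simplify p).
Proof.
elim: p => [b|s t|ts|s t|p _|p _ q _|p _ q _|Q x p IH];
  by [|move/quantifier_free_simplify/andP => []].
Qed.

Lemma nb_symbols_simplify p : nb_symbols (simplify p) <= nb_symbols p.
Proof.
elim: p => [b|s t|ts|s t|p IH|p IHp q IHq|p IHp q IHq|Q x p IH] //.
- by case: simplify_GP.
- by case: simplify_TP.
- by case: simplify_EqP.
- by case: simplify_notP.
- by case: simplify_andP => /=; lia.
- by case: simplify_orP => /=; lia.
Qed.

(** An atom is kept or becomes a truth value of weight 0, and propagating a truth value removes a
    connective. The dichotomy matches [derive], which passes on a quantifier-free query only if
    simplification changed it. *)
Lemma weight_simplify p : simplify p = p \/ weight (simplify p) < weight p.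
Proof.
elim: p => [b|s t|ts|s t|p IH|p IHp q IHq|p IHp q IHq|Q x p IH]; first by left.
- by case: simplify_GP; [right|left].
- by case: simplify_TP; [right|left].
- by case: simplify_EqP; [right|left].
- case: simplify_notP => [b _|_]; first by right.
  by case: IH => [->|]; [left|right].
- have le r : simplify r = r \/ weight (simplify r) < weight r ->
      weight (simplify r) <= weight r by case=> [->|/ltnW].
  case: simplify_andP => /= *; try (by right).
  + by right; move/le: IHq; lia.
  + by right; move/le: IHp; lia.
  + case: IHp => [->|Hp]; last by move/le: IHq; right; lia.
    by case: IHq => [->|Hq]; [left|right; lia].
- have le r : simplify r = r \/ weight (simplify r) < weight r ->
      weight (simplify r) <= weight r by case=> [->|/ltnW].
  case: simplify_orP => /= *; try (by right).
  + by right; move/le: IHq; lia.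
  + by right; move/le: IHp; lia.
  + case: IHp => [->|Hp]; last by move/le: IHq; right; lia.
    by case: IHq => [->|Hq]; [left|right; lia].
- by rewrite /=; case: IH => [->|]; [left|right].
Qed.

Lemma weight_simplify_le p : weight (simplify p) <= weight p.
Proof. by case: (weight_simplify p) => [->|/ltnW]. Qed.

Lemma free_vars_simplify p : {subset free_vars (simplify p) <= free_vars p}.
Proof.
elim: p => [b|s t|ts|s t|p IH|p IHp q IHq|p IHp q IHq|Q x p IH] //.
- by case: simplify_GP.
- by case: simplify_TP.
- by case: simplify_EqP.
- by case: simplify_notP.
- case: simplify_andP => //= *; move=> z; rewrite ?mem_cat.
  + by move/IHq ->; rewrite orbT.
  + by move/IHp ->.
  + by case/orP => [/IHp|/IHq] ->; rewrite ?orbT.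
- case: simplify_orP => //= *; move=> z; rewrite ?mem_cat.
  + by move/IHq ->; rewrite orbT.
  + by move/IHp ->.
  + by case/orP => [/IHp|/IHq] ->; rewrite ?orbT.
- by move=> z /=; rewrite !mem_filter => /andP[-> /IH].
Qed.

Lemma consts_simplify p : {subset consts (simplify p) <= consts p}.
Proof.
elim: p => [b|s t|ts|s t|p IH|p IHp q IHq|p IHp q IHq|Q x p IH] //.
- by case: simplify_GP.
- by case: simplify_TP.
- by case: simplify_EqP.
- by case: simplify_notP.
- case: simplify_andP => //= *; move=> z; rewrite ?mem_cat.
  + by move/IHq ->; rewrite orbT.
  + by move/IHp ->.
  + by case/orP => [/IHp|/IHq] ->; rewrite ?orbT.
- case: simplify_orP => //= *; move=> z; rewrite ?mem_cat.
  + by move/IHq ->; rewrite orbT.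
  + by move/IHp ->.
  + by case/orP => [/IHp|/IHq] ->; rewrite ?orbT.
Qed.

End Simplify.

(** A variable contributes no constant, so equal sizes mean that all terms are constants and the
    valuation is irrelevant. This is the test that [simplify] makes on atoms of [T]. *)
Lemma map_term_val_consts e (ts : seq (term U)) :
  size (flatten [seq term_consts t | t <- ts]) = size ts ->
  map (term_val e) ts = flatten [seq term_consts t | t <- ts].
Proof.
have sz (s : seq (term U)) : size (flatten [seq term_consts t | t <- s]) <= size s.
  by elim: s => //= -[x|a] s IH //=; apply: leqW.
elim: ts => //= -[x|a] ts IH /= H.
  by have := sz ts; rewrite H ltnn.
by rewrite IH //; case: H.
Qed.

Lemma closed_terms_consts (ts : seq (term U)) :
  flatten [seq term_vars t | t <- ts] = [::] ->
  size (flatten [seq term_consts t | t <- ts]) = size ts.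
Proof. by elim: ts => //= -[x|a] ts IH //= /IH ->. Qed.

End Formulas.

(** * Correctness of the prenex normal form *)

Section Prenex.

Variables (U : eqType) (l : nat) (V : seq U).
Hypothesis V_neq0 : V != [::].
Notation formula := (formula U l).
Implicit Types (p q m : formula) (e : nat -> U) (x y k : nat) (a : U).
Implicit Types (pre : seq (quant * nat)) (P : (nat -> U) -> bool).

Fixpoint prefix_sat pre P e : bool :=
  if pre is Qx :: pre' then
    if Qx.1 is Ex then has (fun a => prefix_sat pre' P (upd e Qx.2 a)) V
    else all (fun a => prefix_sat pre' P (upd e Qx.2 a)) V
  else P e.

Definition prefix_formula pre m : formula :=
  foldr (fun Qx q => FQ Qx.1 Qx.2 q) m pre.

Lemma sat_prefix_formula E J pre m e :
  sat V E J e (prefix_formula pre m) = prefix_sat pre (fun e => sat V E J e m) e.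
Proof.
elim: pre e => //= -[[] x] pre IH e /=; [apply: eq_has|apply: eq_all] => a;
  by rewrite IH.
Qed.

Lemma eq_prefix_sat pre P P' e : P =1 P' -> prefix_sat pre P e = prefix_sat pre P' e.
Proof.
move=> PP'; elim: pre e => //= -[[] x] pre IH e /=; [apply: eq_has|apply: eq_all] => a;
  by rewrite IH.
Qed.

Lemma prefix_sat_cat pre1 pre2 P e :
  prefix_sat (pre1 ++ pre2) P e = prefix_sat pre1 (prefix_sat pre2 P) e.
Proof.
elim: pre1 e => //= -[[] x] pre IH e /=; [apply: eq_has|apply: eq_all] => a;
  by rewrite IH.
Qed.

Lemma prefix_sat_not pre P e :
  prefix_sat [seq (quant_flip Qx.1, Qx.2) | Qx <- pre] (fun e => ~~ P e) e =
  ~~ prefix_sat pre P e.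
Proof.
elim: pre e => //= -[[] x] pre IH e /=.
  by rewrite -all_predC; apply: eq_all => a; rewrite IH.
by rewrite -has_predC; apply: eq_has => a; rewrite IH.
Qed.

Definition insensitive P (xs : seq nat) :=
  forall e x a, x \in xs -> P (upd e x a) = P e.

Lemma prefix_sat_and pre P1 P2 e : insensitive P1 (unzip2 pre) ->
  prefix_sat pre (fun e => P1 e && P2 e) e = P1 e && prefix_sat pre P2 e.
Proof.
elim: pre e => //= -[Q x] pre IH e /= H.
have H' : insensitive P1 (unzip2 pre).
  by move=> d y a Hy; apply: H; rewrite inE Hy orbT.
have Ha a : prefix_sat pre (fun e => P1 e && P2 e) (upd e x a) =
    P1 e && prefix_sat pre P2 (upd e x a).
  by rewrite IH // H // inE eqxx.
case: Q H => H.
  rewrite (eq_has Ha); case: (P1 e) => //=; exact: has_pred0.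
(* If [P1 e] fails, a universal quantifier over an empty [V] would still hold; this is where
   [V_neq0] enters. *)
rewrite (eq_all Ha); case: (P1 e) => //=; by case: V V_neq0.
Qed.

Lemma prefix_sat_or pre P1 P2 e : insensitive P1 (unzip2 pre) ->
  prefix_sat pre (fun e => P1 e || P2 e) e = P1 e || prefix_sat pre P2 e.
Proof.
move=> H; apply: negb_inj; rewrite negb_or -!prefix_sat_not.
rewrite (eq_prefix_sat _ _ (fun d => negb_or _ _)) prefix_sat_and //.
move=> d x a Hx; rewrite H //; move: Hx; rewrite /unzip2 -map_comp.
by case/mapP => -[Q y] Hy ->; apply/mapP; exists (Q, y).
Qed.

(** Once the renamed free variables lie below [k], all names from [k] on are fresh, and the two
    operands of a connective draw their bound names from disjoint intervals, so their prefixes may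
    be concatenated. The count is preserved because [nb_symbols] charges one per quantifier;
    prenexing thus leaves the time bounds intact. *)
Lemma prenex_recP E J r k p :
  let: (pre, m, k1) := prenex_rec r k p in
  [/\ quantifier_free m, size pre + nb_symbols m = nb_symbols p,
      {subset consts m <= consts p} &
      (forall y, y \in free_vars p -> r y < k) ->
      [/\ k <= k1, forall x, x \in unzip2 pre -> k <= x < k1,
          {subset free_vars m <= map r (free_vars p) ++ unzip2 pre} &
          forall e, prefix_sat pre (fun e => sat V E J e m) e =
                    sat V E J (fun y => e (r y)) p]].
Proof.
have tv t : term_vars (@term_rename U r t) = map r (term_vars t) by case: t.
have tvl e (t : term U) s : term_val e (term_rename s t) = term_val (fun y => e (s y)) t.
  by case: t.
have tvs (t : term U) s : term_vars (term_rename s t) = map s (term_vars t) by case: t.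
have tc (t : term U) s : term_consts (term_rename s t) = term_consts t by case: t.
elim: p r k {tv} => [b|s t|ts|s t|p IH|p IHp q IHq|p IHp q IHq|Q x p IH] r k.
- by split=> // _; split.
- rewrite /=; split=> [||c|_] //; first by rewrite !tc.
  by split=> // [y|e] /=; rewrite ?cats0 ?map_cat ?tvs // !tvl.
- rewrite /=; split=> // [c|_].
    by rewrite -map_comp (eq_map (fun t => tc t r)).
  split=> // [y|e] /=.
    rewrite cats0 -map_comp; elim: (tval ts) => //= t s IH.
    by rewrite map_cat tvs !mem_cat => /orP[->|/IH ->] //; rewrite orbT.
  congr (J _); apply: val_inj => /=; rewrite -map_comp; apply: eq_map => t /=.
  exact: tvl.
- rewrite /=; split=> [||c|_] //; first by rewrite !tc.
  by split=> // [y|e] /=; rewrite ?cats0 ?map_cat ?tvs // !tvl.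
- rewrite /=; move: (IH r k); case: (prenex_rec r k p) => -[pre m] k1 /= [qm nm cm H].
  have u2 : unzip2 [seq (quant_flip Qx.1, Qx.2) | Qx <- pre] = unzip2 pre.
    by rewrite /unzip2 -map_comp.
  split=> //; first by rewrite size_map.
  by move=> /H[? ? ? Hs]; rewrite u2; split=> // e; rewrite prefix_sat_not Hs.
- rewrite /=; move: (IHp r k); case: (prenex_rec r k p) => -[pre1 m1] k1 /= [qm1 nm1 cm1 H1].
  move: (IHq r k1); case: (prenex_rec r k1 q) => -[pre2 m2] k2 /= [qm2 nm2 cm2 H2].
  split; first by rewrite qm1.
  + by rewrite size_cat; lia.
  + by move=> c; rewrite !mem_cat => /orP[/cm1|/cm2] ->; rewrite ?orbT.
  move=> H; case: H1 => [y Hy|kk1 B1 F1 S1]; first by apply: H; rewrite mem_cat Hy.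
  have Hq y : y \in free_vars q -> r y < k by move=> Hy; apply: H; rewrite mem_cat Hy orbT.
  case: H2 => [y /Hq|kk2 B2 F2 S2]; first by move/leq_trans; apply.
  have u2 : unzip2 (pre1 ++ pre2) = unzip2 pre1 ++ unzip2 pre2 by rewrite /unzip2 map_cat.
  have Hp y : y \in free_vars p -> r y < k by move=> Hy; apply: H; rewrite mem_cat Hy.
  have I1 : insensitive (fun e => sat V E J e m1) (unzip2 pre2).
    move=> e x a /B2 Hx; apply: sat_ext => y /F1; rewrite /upd mem_cat.
    case: (eqVneq y x) => // -> /orP[/mapP[z /Hp]|/B1]; lia.
  have I2 : insensitive (fun e => prefix_sat pre2 (fun e => sat V E J e m2) e) (unzip2 pre1).
    move=> e x a /B1 Hx; rewrite !S2; apply: sat_ext => y /Hq ry; rewrite /upd.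
    by case: eqVneq => // ryx; lia.
  split=> [|x|y|e].
  + lia.
  + by rewrite u2 mem_cat => /orP[/B1|/B2]; lia.
  + rewrite u2 map_cat !mem_cat => /orP[/F1|/F2]; rewrite mem_cat => /orP[] ->;
      by rewrite ?orbT.
  (* First [pre2] moves past [m1]; then, with the conjuncts swapped, [pre1] moves past the whole
     quantified second operand. *)
  + rewrite prefix_sat_cat (eq_prefix_sat _ _ (fun d => prefix_sat_and _ _ I1)).
    rewrite (eq_prefix_sat _ _ (fun d => andbC _ _)) (prefix_sat_and _ _ I2).
    by rewrite S1 S2 andbC.
- rewrite /=; move: (IHp r k); case: (prenex_rec r k p) => -[pre1 m1] k1 /= [qm1 nm1 cm1 H1].
  move: (IHq r k1); case: (prenex_rec r k1 q) => -[pre2 m2] k2 /= [qm2 nm2 cm2 H2].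
  split; first by rewrite qm1.
  + by rewrite size_cat; lia.
  + by move=> c; rewrite !mem_cat => /orP[/cm1|/cm2] ->; rewrite ?orbT.
  move=> H; case: H1 => [y Hy|kk1 B1 F1 S1]; first by apply: H; rewrite mem_cat Hy.
  have Hq y : y \in free_vars q -> r y < k by move=> Hy; apply: H; rewrite mem_cat Hy orbT.
  case: H2 => [y /Hq|kk2 B2 F2 S2]; first by move/leq_trans; apply.
  have u2 : unzip2 (pre1 ++ pre2) = unzip2 pre1 ++ unzip2 pre2 by rewrite /unzip2 map_cat.
  have Hp y : y \in free_vars p -> r y < k by move=> Hy; apply: H; rewrite mem_cat Hy.
  have I1 : insensitive (fun e => sat V E J e m1) (unzip2 pre2).
    move=> e x a /B2 Hx; apply: sat_ext => y /F1; rewrite /upd mem_cat.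
    case: (eqVneq y x) => // -> /orP[/mapP[z /Hp]|/B1]; lia.
  have I2 : insensitive (fun e => prefix_sat pre2 (fun e => sat V E J e m2) e) (unzip2 pre1).
    move=> e x a /B1 Hx; rewrite !S2; apply: sat_ext => y /Hq ry; rewrite /upd.
    by case: eqVneq => // ryx; lia.
  split=> [|x|y|e].
  + lia.
  + by rewrite u2 mem_cat => /orP[/B1|/B2]; lia.
  + rewrite u2 map_cat !mem_cat => /orP[/F1|/F2]; rewrite mem_cat => /orP[] ->;
      by rewrite ?orbT.
  + rewrite prefix_sat_cat (eq_prefix_sat _ _ (fun d => prefix_sat_or _ _ I1)).
    rewrite (eq_prefix_sat _ _ (fun d => orbC _ _)) (prefix_sat_or _ _ I2).
    by rewrite S1 S2 orbC.
- rewrite /=; set r' := fun y => _; move: (IH r' k.+1).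
  case: (prenex_rec r' k.+1 p) => -[pre m] k1 /= [qm nm cm H].
  split=> //; first by rewrite /=; lia.
  move=> Hr; case: H => [y Hy|kk1 B F S].
    rewrite /r'; case: eqVneq => // yx; apply/ltnW; rewrite ltnS.
    by apply: Hr; rewrite mem_filter yx.
  split=> [|y|y /F|e].
  + lia.
  + by rewrite inE => /orP[/eqP ->|/B]; lia.
  + rewrite !mem_cat inE => /orP[/mapP[z Hz ->]|->]; last by rewrite !orbT.
    rewrite /r'; case: eqVneq => [_|zx]; first by rewrite eqxx orbT.
    by rewrite (map_f r) // mem_filter zx.
  + have Ha a : prefix_sat pre (fun e => sat V E J e m) (upd e k a) =
                sat V E J (fun y => if y == x then a else e (r y)) p.
      rewrite S; apply: sat_ext => y Hy; rewrite /r' /upd.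
      case: (eqVneq y x) => [_|yx]; first by rewrite eqxx.
      have := Hr y; rewrite mem_filter yx Hy => /(_ isT).
      by case: eqVneq => // ->; rewrite ltnn.
    by case: Q; [apply: eq_has|apply: eq_all].
Qed.

Lemma is_prenex_prenex xs p : is_prenex (prenex xs p).
Proof.
rewrite /prenex; move: (prenex_recP (fun _ _ => false) pred0 id (\max_(x <- xs) x).+1 p).
case: prenex_rec => -[pre m] k1 [qm _ _ _].
by elim: pre => //=; case: m qm.
Qed.

Lemma nb_symbols_prenex xs p : nb_symbols (prenex xs p) = nb_symbols p.
Proof.
rewrite /prenex; move: (prenex_recP (fun _ _ => false) pred0 id (\max_(x <- xs) x).+1 p).
case: prenex_rec => -[pre m] k1 [_ <- _ _].
by elim: pre => //= _ pre ->.
Qed.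

Lemma consts_prenex xs p : {subset consts (prenex xs p) <= consts p}.
Proof.
rewrite /prenex; move: (prenex_recP (fun _ _ => false) pred0 id (\max_(x <- xs) x).+1 p).
case: prenex_rec => -[pre m] k1 [_ _ cm _] c Hc; apply: cm.
by elim: pre Hc.
Qed.

Lemma leq_max_seq (xs : seq nat) x : x \in xs -> x < (\max_(x <- xs) x).+1.
Proof. by move=> Hx; rewrite ltnS; exact: (@leq_bigmax_seq _ xs xpredT id). Qed.

Lemma mem_free_prefix pre m y :
  (y \in free_vars (prefix_formula pre m)) =
  (y \in free_vars m) && (y \notin unzip2 pre).
Proof.
elim: pre => /= [|Qx pre IH]; first by rewrite andbT.
by rewrite mem_filter IH inE negb_or andbCA.
Qed.

Lemma free_vars_prenex xs p : {subset free_vars p <= xs} ->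
  {subset free_vars (prenex xs p) <= xs}.
Proof.
move=> sub; rewrite /prenex.
move: (prenex_recP (fun _ _ => false) pred0 id (\max_(x <- xs) x).+1 p).
case: prenex_rec => -[pre m] k1 [_ _ _ []] => [y /sub/leq_max_seq //|_ _ F _].
rewrite -/(prefix_formula pre m) => y; rewrite mem_free_prefix => /andP[/F].
by rewrite map_id mem_cat => /orP[/sub|->].
Qed.

Lemma sat_prenex E J xs p e : {subset free_vars p <= xs} ->
  sat V E J e (prenex xs p) = sat V E J e p.
Proof.
move=> sub; rewrite /prenex.
move: (prenex_recP E J id (\max_(x <- xs) x).+1 p).
case: prenex_rec => -[pre m] k1 [_ _ _ []] => [y /sub/leq_max_seq //|_ _ _ S].
by rewrite -/(prefix_formula pre m) sat_prefix_formula S.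
Qed.

End Prenex.

(** * The query and answer tables of a single node *)

Section LocalEngine.

Variables (U : eqType) (l : nat).
Notation formula := (formula U l).
Notation query := (query U l).
Notation message := (message U l).
Notation fo_state := (fo_state U l).
Implicit Types (p r : formula) (q : query) (s : fo_state) (m : message) (b : bool).

Definition known s q : bool := q \in unzip1 (fo_queries s).
Definition answered s p : bool := isSome (fo_answer s p).
Definition quantified p : bool := if p is FQ _ _ _ then true else false.

Definition sent_query q (ms : seq message) : bool :=
  has (fun m => if m is MQuery q' then q' == q else false) ms.
Definition sent_answer p (ms : seq message) : bool :=
  has (fun m => if m is MAnswer p' _ then p' == p else false) ms.
(** Every message sent is backed by the sender's tables. The value [false] on the remaining messages
    records that the first-order engine never emits an informing message. *)
Definition justified s m : bool :=
  match m with
  | MQuery q => known s q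
  | MAnswer p b => (p, b) \in fo_answers s
  | _ => false
  end.

Lemma answeredE s p :
  answered s p = (if p is FBool _ then true else false) || (p \in unzip1 (fo_answers s)).
Proof.
have H : isSome (ohead [seq e.2 | e <- fo_answers s & e.1 == p]) =
    (p \in unzip1 (fo_answers s)).
  elim: (fo_answers s) => //= -[r b] es IH /=.
  by rewrite inE eq_sym; case: eqVneq.
by rewrite /answered; case: p H.
Qed.

Lemma fo_answer_mem s p b : fo_answer s p = Some b ->
  p = FBool b \/ (p, b) \in fo_answers s.
Proof.
have H : ohead [seq e.2 | e <- fo_answers s & e.1 == p] = Some b ->
    (p, b) \in fo_answers s.
  elim: (fo_answers s) => //= -[r c] es IH /=.
  case: eqVneq => [->|_] /=; first by case=> ->; rewrite inE eqxx.
  by move/IH; rewrite inE orbC => ->.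
by case: p H => [c _ [->]|s1 t H /H|ts H /H|s1 t H /H|p H /H|p1 p2 H /H|p1 p2 H /H|Q x p H /H];
  [left|right..].
Qed.

Lemma answeredP s p : answered s p -> exists b, fo_answer s p = Some b.
Proof. by rewrite /answered; case: fo_answer => // b; exists b. Qed.

(** Compares what a node only accumulates. Clocks and outgoing messages are absent: a round drops
    expired clocks and starts with nothing to send. *)
Definition state_le s s' : Prop :=
  [/\ {subset fo_queries s <= fo_queries s'},
      {subset fo_answers s <= fo_answers s'} &
      {subset fo_buffer s <= fo_buffer s'}].

Lemma state_le_refl s : state_le s s. Proof. by split. Qed.

Lemma state_le_trans s2 s1 s3 : state_le s1 s2 -> state_le s2 s3 -> state_le s1 s3.
Proof.
by case=> a1 b1 c1 [a2 b2 c2]; split=> x; [move/a1/a2|move/b1/b2|move/c1/c2].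
Qed.

Lemma map_subset (A B : eqType) (f : A -> B) (s1 s2 : seq A) :
  {subset s1 <= s2} -> {subset map f s1 <= map f s2}.
Proof. by move=> H _ /mapP[x /H Hx ->]; apply: map_f. Qed.

Lemma known_le s s' q : state_le s s' -> known s q -> known s' q.
Proof. by case=> H _ _; apply: map_subset. Qed.

Lemma answered_le s s' p : state_le s s' -> answered s p -> answered s' p.
Proof.
case=> _ H _; rewrite !answeredE => /orP[->|] //.
by move/(map_subset (f := fst) H) => ->; rewrite orbT.
Qed.

Lemma justified_le s s' m : state_le s s' -> justified s m -> justified s' m.
Proof. by move=> le; case: m => //= [q|p b]; [apply: known_le|case: le => _ H _ /H]. Qed.

Lemma learn_le p b s : state_le s (fo_learn p b s).
Proof.
rewrite /fo_learn; case: fo_answer => [_|]; split=> //= x Hx; rewrite inE Hx //.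
by rewrite orbT.
Qed.

Lemma store_le cs s : state_le s (fo_store cs s).
Proof. by rewrite /fo_store; case: ifP => _; split=> //= x Hx; rewrite inE Hx orbT. Qed.

Lemma learn_answered p b s : answered (fo_learn p b s) p.
Proof.
rewrite answeredE /fo_learn; case Hp: (fo_answer s p) => [c|] /=; last first.
  by rewrite inE eqxx orbT.
by rewrite -answeredE /answered Hp.
Qed.

Lemma learn_id p b s : answered s p -> fo_learn p b s = s.
Proof. by rewrite /answered /fo_learn; case: fo_answer. Qed.

Lemma store_id cs s : cs \in fo_buffer s -> fo_store cs s = s.
Proof. by rewrite /fo_store => ->. Qed.

Lemma store_mem cs s : cs \in fo_buffer (fo_store cs s).
Proof. by rewrite /fo_store; case: ifP => //= _; rewrite inE eqxx. Qed.

Lemma learn_queries p b s : fo_queries (fo_learn p b s) = fo_queries s.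
Proof. by rewrite /fo_learn; case: fo_answer. Qed.

Lemma learn_clocks p b s : fo_clocks (fo_learn p b s) = fo_clocks s.
Proof. by rewrite /fo_learn; case: fo_answer. Qed.

Lemma store_queries cs s : fo_queries (fo_store cs s) = fo_queries s.
Proof. by rewrite /fo_store; case: ifP. Qed.

Lemma store_clocks cs s : fo_clocks (fo_store cs s) = fo_clocks s.
Proof. by rewrite /fo_store; case: ifP. Qed.

(** * Saturation *)

Variant conclude_spec s p : query -> fo_state -> Prop :=
| ConcludeNone par : conclude_spec s p par s
| ConcludeEx x r of fo_answer s p = Some true :
    conclude_spec s p (QBool (FQ Ex x r)) (fo_learn (FQ Ex x r) true s)
| ConcludeAll x r of fo_answer s p = Some false :
    conclude_spec s p (QBool (FQ All x r)) (fo_learn (FQ All x r) false s)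
| ConcludeQF r b of ~~ quantified r & fo_answer s p = Some b :
    conclude_spec s p (QBool r) (fo_learn r b s)
| ConcludeOpen xs cs r of fo_answer s p = Some true :
    conclude_spec s p (QOpen xs cs r) (fo_store cs s).

Lemma concludeP s p par : conclude_spec s p par (fo_conclude s (QBool p, Some par)).
Proof.
rewrite /fo_conclude; case Hp: (fo_answer s p) => [b|]; last by constructor.
case: par => [xs cs r|r].
  by case: b Hp => Hp; [apply: ConcludeOpen|apply: ConcludeNone].
case: r => [c|s1 t|ts|s1 t|r|r1 r2|r1 r2|[] x r]; try by apply: ConcludeQF.
  by case: b Hp => Hp; [apply: ConcludeEx|apply: ConcludeNone].
by case: b Hp => Hp; [apply: ConcludeNone|apply: ConcludeAll].
Qed.

Lemma conclude_ind (P : fo_state -> Prop) s e :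
  P s ->
  (forall p q s', e = (QBool p, Some q) -> conclude_spec s p q s' -> P s') ->
  P (fo_conclude s e).
Proof.
by case: e => -[xs cs r|p] [q|] // Ps H; apply: (H p q) => //; apply: concludeP.
Qed.

Lemma conclude_queries s e : fo_queries (fo_conclude s e) = fo_queries s.
Proof.
elim/conclude_ind: (fo_conclude s e) => // p q s' _ [] *;
  by rewrite ?learn_queries ?store_queries.
Qed.

Lemma conclude_clocks s e : fo_clocks (fo_conclude s e) = fo_clocks s.
Proof.
elim/conclude_ind: (fo_conclude s e) => // p q s' _ [] *;
  by rewrite ?learn_clocks ?store_clocks.
Qed.

Lemma conclude_le s e : state_le s (fo_conclude s e).
Proof.
elim/conclude_ind: (fo_conclude s e) => [|p q s' _ [] *]; first exact: state_le_refl;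
  by [exact: state_le_refl|exact: learn_le|exact: store_le].
Qed.

(* Each pass of [fo_saturate] that changes the state settles a further entry, so
   as many passes as there are entries suffice. *)
Definition settled s (e : query * option query) : bool :=
  match e with
  | (QBool _, Some (QBool r)) => answered s r
  | (QBool _, Some (QOpen _ cs _)) => cs \in fo_buffer s
  | _ => true
  end.

Lemma settled_le s s' e : state_le s s' -> settled s e -> settled s' e.
Proof.
move=> le; case: e => -[xs cs r|p] [[xs' cs' r'|r'']|] //=; last exact: answered_le.
by case: le => _ _ H /H.
Qed.

Lemma settled_conclude s e : settled s e -> fo_conclude s e = s.
Proof.
case: e => -[xs cs r|p] [q|] //.
by case: (concludeP s p q) => [q0|x r0 _|x r0 _|r0 b _ _|xs cs r0 _] //= H;
  rewrite ?learn_id ?store_id.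
Qed.

Lemma conclude_settles s e :
  fo_conclude s e = s \/ ~~ settled s e /\ settled (fo_conclude s e) e.
Proof.
case He: (settled s e); first by left; apply: settled_conclude.
case: e He => -[xs cs r|p] [q|]; try by left.
by case: (concludeP s p q) => [q0|x r0 _|x r0 _|r0 b _ _|xs cs r0 _] He; [left|right..];
  split=> //=; rewrite ?learn_answered ?store_mem.
Qed.

Definition saturated s : Prop :=
  forall e, e \in fo_queries s -> fo_conclude s e = s.

Lemma foldl_conclude_queries s es : fo_queries (foldl (@fo_conclude U l) s es) = fo_queries s.
Proof. by elim: es s => //= e es IH s; rewrite IH conclude_queries. Qed.

Lemma foldl_conclude_le s es : state_le s (foldl (@fo_conclude U l) s es).
Proof.
elim: es s => [|e es IH] s; first exact: state_le_refl.
exact: state_le_trans (conclude_le s e) (IH _).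
Qed.

Lemma foldl_conclude_progress s es :
  (forall e, e \in es -> fo_conclude s e = s) \/
  exists2 e, e \in es & ~~ settled s e && settled (foldl (@fo_conclude U l) s es) e.
Proof.
elim: es s => [|e es IH] s /=; first by left.
case: (conclude_settles s e) => [Hs|[He He']]; last first.
  right; exists e; first by rewrite inE eqxx.
  by rewrite He (settled_le (foldl_conclude_le _ _) He').
rewrite Hs; case: (IH s) => [H|[e' e'es He']].
  by left=> e'; rewrite inE => /orP[/eqP ->|/H].
by right; exists e' => //; rewrite inE e'es orbT.
Qed.

Lemma saturated_settled s : all (settled s) (fo_queries s) -> saturated s.
Proof. by move/allP => H e /H; apply: settled_conclude. Qed.

Lemma foldl_conclude_id s es : (forall e, e \in es -> fo_conclude s e = s) ->
  foldl (@fo_conclude U l) s es = s.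
Proof.
elim: es => //= e es IH H; rewrite H ?inE ?eqxx // IH // => e' He'.
by rewrite H // inE He' orbT.
Qed.

Lemma count_lt (T : eqType) (a1 a2 : pred T) (ts : seq T) x :
  subpred a1 a2 -> x \in ts -> ~~ a1 x -> a2 x -> count a1 ts < count a2 ts.
Proof.
move=> sub + H1 H2; elim: ts => //= y ts IH; rewrite inE => /orP[/eqP <-|/IH].
  by rewrite (negbTE H1) H2 add0n add1n ltnS sub_count.
by have := @sub y; case: (a1 y) => [/(_ isT) ->|_]; lia.
Qed.

Lemma saturate_saturated s : saturated (fo_saturate s).
Proof.
rewrite /fo_saturate; set f := fun s' => _; set qs := fo_queries s.
have Hq n : fo_queries (iter n f s) = qs.
  by elim: n => //= n IH; rewrite /f foldl_conclude_queries.
have H n : saturated (iter n f s) \/ n <= count (settled (iter n f s)) qs.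
  elim: n => [|n IH] /=; first by right.
  case: IH => [sat|IH]; first by left; rewrite /f foldl_conclude_id.
  case: (foldl_conclude_progress (iter n f s) (fo_queries (iter n f s))) => [sat|[e]].
    by left; rewrite /f foldl_conclude_id.
  rewrite Hq => eqs /andP[He He']; right; apply: leq_ltn_trans IH _.
  rewrite {2}/f Hq; move: He He'; set s1 := iter n f s; set s2 := foldl _ _ _ => He He'.
  by apply: (count_lt _ eqs He He') => e'; apply: settled_le; apply: foldl_conclude_le.
case: (H (size qs)) => // Hc; apply: saturated_settled.
by rewrite Hq all_count eqn_leq count_size.
Qed.

Lemma saturate_ind (P : fo_state -> Prop) s :
  P s ->
  (forall s' e, fo_queries s' = fo_queries s -> e \in fo_queries s -> P s' ->
    P (fo_conclude s' e)) ->
  P (fo_saturate s).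
Proof.
move=> Ps H.
have fold es s1 : {subset es <= fo_queries s} -> P s1 -> fo_queries s1 = fo_queries s ->
    P (foldl (@fo_conclude U l) s1 es).
  elim: es s1 => //= e es IH s1 sub P1 H1; apply: IH.
  - by move=> e' He'; apply: sub; rewrite inE He' orbT.
  - by apply: H => //; apply: sub; rewrite inE eqxx.
  - by rewrite conclude_queries.
rewrite /fo_saturate; set f := fun s' => _.
suff [] : P (iter (size (fo_queries s)) f s) /\
    fo_queries (iter (size (fo_queries s)) f s) = fo_queries s by [].
elim: (size _) => //= n [Pn Hn]; rewrite /f foldl_conclude_queries Hn; split=> //.
exact: fold.
Qed.

Lemma saturate_clocks s : fo_clocks (fo_saturate s) = fo_clocks s.
Proof. by elim/saturate_ind: (fo_saturate s) => // s' e H _; rewrite conclude_clocks. Qed.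

Lemma saturate_le s : state_le s (fo_saturate s).
Proof.
elim/saturate_ind: (fo_saturate s) => [|s' e _ _ H]; first exact: state_le_refl.
exact: state_le_trans H (conclude_le _ _).
Qed.

(** In a saturated state concluding the entry changes nothing, yet it would add an answer to [r] if
    there were none. A quantified [r] is settled only by a witness or a counterevidence, hence the
    condition on [b]. *)
Lemma saturated_answered s p r b : saturated s ->
  (QBool p, Some (QBool r)) \in fo_queries s -> fo_answer s p = Some b ->
  (if r is FQ Q _ _ then b = (if Q is Ex then true else false) else True) ->
  answered s r.
Proof.
move=> sat He Hp Hr; move/sat: He; rewrite /fo_conclude Hp.
have id c : fo_learn r c s = s -> answered s r.
  by move=> <-; apply: learn_answered.
by case: r Hr id => [c|s1 t|ts|s1 t|r|r1 r2|r1 r2|[] x r] //= Hr id; rewrite ?Hr => /id.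
Qed.

Lemma saturated_stored s p xs cs r : saturated s ->
  (QBool p, Some (QOpen xs cs r)) \in fo_queries s -> fo_answer s p = Some true ->
  cs \in fo_buffer s.
Proof.
move=> sat He Hp; move/sat: He; rewrite /fo_conclude Hp => <-; exact: store_mem.
Qed.

(** * Posing queries *)

Section AtNode.

Variables (i : local_info U) (tbl : table U).

(** The extra unit for open queries pays for the passage from a fully instantiated query to its
    Boolean query, where the formula stays the same. *)
Definition query_weight q : nat :=
  match q with
  | QOpen xs _ p => (size xs + weight p).+1
  | QBool p => weight p
  end.

Lemma query_weight_depth q : query_weight q <= query_depth q.
Proof. by case: q => [xs cs p|p] /=; have := weight_size p; lia. Qed.

Lemma derive_weight q q' : derive i tbl q = Some q' -> query_weight q' < query_weight q.
Proof.
have H p : simplify i tbl p != p -> weight (simplify i tbl p) < weight p.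
  by case: (weight_simplify i tbl p) => [->|//]; rewrite eqxx.
case: q => [[|x xs] cs p|p] /=.
- by case: eqP => // _ [<-].
- by case=> <- /=; have := weight_simplify_le i tbl (subst (last x xs) (self i) p);
    rewrite weight_subst size_belast; lia.
- case: p => [b|s1 t|ts|s1 t|p|p1 p2|p1 p2|Q x p]; try by case: ifP => // /negbT /H ? [<-].
  by case=> <- /=; have := weight_simplify_le i tbl (subst x (self i) p);
    rewrite weight_subst.
Qed.

Definition pose1 q (par : option query) s : fo_state :=
  let s1 := fo_record (q, par) s in
  let s2 := if par is Some _ then wait_for i q s1 else s1 in
  if known s q || is_truth_value q then s2 else fo_send (MQuery q) s2.

Lemma fo_poseE k q par s :
  fo_pose i tbl k q par s =
  if known s q || is_truth_value q then pose1 q par s else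
  if k is k'.+1 then
    if derive i tbl q is Some q' then fo_pose i tbl k' q' (Some q) (pose1 q par s)
    else pose1 q par s
  else pose1 q par s.
Proof. by rewrite /pose1; case: k => [|k] /=; rewrite -/(known s q); case: ifP. Qed.

Lemma wait_queries q s : fo_queries (wait_for i q s) = fo_queries s.
Proof. by case: q => // -[] // Q x p /=; rewrite /fo_set_clock; case: ifP. Qed.
Lemma wait_answers q s : fo_answers (wait_for i q s) = fo_answers s.
Proof. by case: q => // -[] // Q x p /=; rewrite /fo_set_clock; case: ifP. Qed.
Lemma wait_buffer q s : fo_buffer (wait_for i q s) = fo_buffer s.
Proof. by case: q => // -[] // Q x p /=; rewrite /fo_set_clock; case: ifP. Qed.
Lemma wait_out q s : fo_out (wait_for i q s) = fo_out s.
Proof. by case: q => // -[] // Q x p /=; rewrite /fo_set_clock; case: ifP. Qed.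

Lemma pose1_queries q par s e :
  (e \in fo_queries (pose1 q par s)) = (e == (q, par)) || (e \in fo_queries s).
Proof.
have -> : fo_queries (pose1 q par s) = fo_queries (fo_record (q, par) s).
  by rewrite /pose1; case: par => [q0|]; case: ifP => _ /=; rewrite ?wait_queries.
rewrite /fo_record; case: ifP => //= H.
by case: eqP => // ->; rewrite H.
Qed.

Lemma pose1_answers q par s : fo_answers (pose1 q par s) = fo_answers s.
Proof.
by rewrite /pose1 /fo_record; case: par => [q0|]; case: ifP; case: ifP => _ _ /=;
  rewrite ?wait_answers.
Qed.

Lemma pose1_buffer q par s : fo_buffer (pose1 q par s) = fo_buffer s.
Proof.
by rewrite /pose1 /fo_record; case: par => [q0|]; case: ifP; case: ifP => _ _ /=;
  rewrite ?wait_buffer.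
Qed.

Lemma pose1_out q par s : fo_out (pose1 q par s) =
  if known s q || is_truth_value q then fo_out s else rcons (fo_out s) (MQuery q).
Proof.
by rewrite /pose1 /fo_record; case: par => [q0|]; case: ifP; case: ifP => _ _ /=;
  rewrite ?wait_out.
Qed.

Lemma pose1_clocks q par s :
  fo_clocks (pose1 q par s) =
  match q, par with
  | QBool (FQ _ _ _ as p), Some _ =>
      if p \in unzip1 (fo_clocks s) then fo_clocks s
      else (p, 2 * net_diam i * nb_symbols p) :: fo_clocks s
  | _, _ => fo_clocks s
  end.
Proof.
have -> : fo_clocks (pose1 q par s) =
    fo_clocks (if par is Some _ then wait_for i q (fo_record (q, par) s)
               else fo_record (q, par) s).
  by rewrite /pose1; case: par => [q0|]; case: ifP.
have Hr e : fo_clocks (fo_record e s) = fo_clocks s by rewrite /fo_record; case: ifP.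
case: par => [q0|]; last by rewrite Hr; case: q => // -[].
case: q => [xs cs p|p]; first by rewrite Hr.
case: p => *; rewrite /wait_for ?Hr // /fo_set_clock Hr.
by case: ifP => _ //=; rewrite Hr.
Qed.

Lemma pose1_le q par s : state_le s (pose1 q par s).
Proof.
by split=> [e||]; rewrite ?pose1_answers ?pose1_buffer // pose1_queries => ->;
  rewrite orbT.
Qed.

Lemma pose1_known q par s q' : known (pose1 q par s) q' = (q' == q) || known s q'.
Proof.
rewrite /known; apply/mapP/orP => [[[q1 par1]]|[/eqP ->|/mapP[e He ->]]].
- rewrite pose1_queries => /orP[/eqP[-> _] /= ->|H ->]; first by left.
  by right; apply/mapP; exists (q1, par1).
- by exists (q, par); rewrite ?pose1_queries ?eqxx.
- by exists e; rewrite ?pose1_queries ?He ?orbT.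
Qed.

Definition may_pose (G : query -> Prop) q (par : option query) s : Prop :=
  if par is Some q0 then
    [/\ known s q0, ~~ is_truth_value q0 & derive i tbl q0 = Some q]
  else G q.

(** Posing is a chain of [pose1] steps, each on the query derived from the preceding one, so a
    property kept by single steps survives whatever the fuel. [may_pose] records how a query is
    linked to its parent. *)
Lemma fo_pose_ind G (P : fo_state -> Prop) k q par s :
  (forall q par s, may_pose G q par s -> P s -> P (pose1 q par s)) ->
  may_pose G q par s -> P s -> P (fo_pose i tbl k q par s).
Proof.
move=> H; elim: k q par s => [|k IH] q par s Hq Ps; rewrite fo_poseE.
  by case: ifP => _; apply: H.
case: ifP => [_|/negbT]; first exact: H.
rewrite negb_or => /andP[_ Ht]; case Hd: derive => [q'|]; last exact: H.
by apply: IH; [split; rewrite ?pose1_known ?eqxx|apply: H].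
Qed.

Lemma fo_pose_entry k q par s : (q, par) \in fo_queries (fo_pose i tbl k q par s).
Proof.
elim: k q par s => [|k IH] q par s; rewrite fo_poseE.
  by case: ifP => _; rewrite pose1_queries eqxx.
case: ifP => _; first by rewrite pose1_queries eqxx.
case Hd: derive => [q'|]; last by rewrite pose1_queries eqxx.
have [le _ _] : state_le (pose1 q par s) (fo_pose i tbl k q' (Some q) (pose1 q par s)).
  move: (Some q) (pose1 q par s) => par1 s1 {s Hd par}.
  elim: k q' par1 s1 {IH q} => [|k IH] q par s; rewrite fo_poseE.
    by case: ifP => _; apply: pose1_le.
  case: ifP => _; first exact: pose1_le.
  case: derive => [q'|]; last exact: pose1_le.
  exact: state_le_trans (pose1_le _ _ _) (IH _ _ _).
by apply: le; rewrite pose1_queries eqxx.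
Qed.

Lemma fo_pose_le k q par s : state_le s (fo_pose i tbl k q par s).
Proof.
elim: k q par s => [|k IH] q par s; rewrite fo_poseE.
  by case: ifP => _; apply: pose1_le.
case: ifP => _; first exact: pose1_le.
case: derive => [q'|]; last exact: pose1_le.
exact: state_le_trans (pose1_le _ _ _) (IH _ _ _).
Qed.

(* Every query but those in [X], whose treatment is under way, has been
   treated. *)
Definition derived_but (X : seq query) s : Prop :=
  forall q q', known s q -> ~~ is_truth_value q -> q \notin X ->
    derive i tbl q = Some q' -> (q', Some q) \in fo_queries s.

(** While the subquery of [q] is being posed, [q] is known but not yet treated; hence [X] is
    generalised and grows by [q] in the recursive call. Fuel at least the weight ensures that the
    chain is never cut off. *)
Lemma fo_pose_derived X k q par s : query_weight q <= k ->
  derived_but X s -> derived_but X (fo_pose i tbl k q par s).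
Proof.
elim: k X q par s => [|k IH] X q par s Hk Hs; rewrite fo_poseE.
all: have Hs' : known s q || is_truth_value q -> derived_but X (pose1 q par s).
1,3: move=> Hq q1 q2; rewrite pose1_known pose1_queries => /orP[/eqP ->|K1] Ht HX Hd;
  [move: Hq; rewrite (negbTE Ht) orbF => K1|]; by rewrite Hs ?orbT.
all: have Hs2 : derived_but (q :: X) (pose1 q par s).
1,3: move=> q1 q2; rewrite pose1_known pose1_queries inE negb_or
       => /orP[->//|K1] Ht /andP[_ HX] Hd; by rewrite Hs ?orbT.
- case: ifP => // _ q1 q2 K1 Ht HX Hd.
  case: (eqVneq q1 q) => [q1q|q1q]; last by apply: Hs2 => //; rewrite inE negb_or q1q.
  (* The fuel is 0, so [q] has weight 0 and nothing can be derived from it. *)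
  by move/derive_weight: Hd; rewrite q1q; lia.
- case: ifP => // _; case Hq: derive => [q'|] q1 q2 K1 Ht HX Hd.
    case: (eqVneq q1 q) => [q1q|q1q].
      by move: Hd; rewrite q1q Hq => -[<-]; apply: fo_pose_entry.
    have lt := derive_weight Hq.
    by apply: (IH (q :: X) q' (Some q) _ _ Hs2) => //; [lia|rewrite inE negb_or q1q].
  case: (eqVneq q1 q) => [q1q|q1q]; last by apply: Hs2 => //; rewrite inE negb_or q1q.
  by move: Hd; rewrite q1q Hq.
Qed.

End AtNode.

End LocalEngine.

(** * What posing, receiving and expiring preserve at a node *)

Section NodeInvariant.

Variables (U : eqType) (l : nat).
Notation formula := (formula U l).
Notation query := (query U l).
Notation message := (message U l).
Notation fo_state := (fo_state U l).
Implicit Types (p r : formula) (q : query) (s : fo_state) (m : message) (b : bool).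

Variables (i : local_info U) (tbl : table U).

(* During a round, [Q0] and [A0] are the queries and answers that the node knew
   before the round, [C] is what is known of the clocks and [G] what holds of
   all queries. *)
Record node_inv (Q0 : pred query) (A0 : pred formula) (C : formula -> nat -> Prop)
    (G : query -> Prop) s : Prop := NodeInv {
  inv_out : all (justified s) (fo_out s);
  inv_entry : forall q q', (q', Some q) \in fo_queries s ->
    [/\ known s q, ~~ is_truth_value q & derive i tbl q = Some q'];
  inv_clock : forall p c, (p, c) \in fo_clocks s ->
    [/\ quantified p, known s (QBool p) & C p c];
  inv_wait : forall p q, (QBool p, Some q) \in fo_queries s -> quantified p ->
    p \in unzip1 (fo_clocks s) \/ answered s p;
  inv_sent_query : forall q, known s q -> ~~ is_truth_value q ->
    Q0 q \/ sent_query q (fo_out s);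
  inv_sent_answer : forall p, p \in unzip1 (fo_answers s) ->
    A0 p \/ sent_answer p (fo_out s);
  inv_good : forall q, known s q -> G q;
  inv_derived : derived_but i tbl [::] s
}.

Variables (Q0 : pred query) (A0 : pred formula).
Variables (C : formula -> nat -> Prop) (G : query -> Prop).
Hypothesis C_init : forall p, C p (2 * net_diam i * nb_symbols p).
Hypothesis G_derive : forall q q', G q -> derive i tbl q = Some q' -> G q'.

Notation inv := (node_inv Q0 A0 C G).

Lemma inv_learn p b s : inv s -> inv (fo_learn p b s).
Proof.
rewrite /fo_learn; case Hp: fo_answer => [//|] [].
move=> iout ient iclk iwait isq isa igood ider.
have le : state_le s (FOState (fo_queries s) ((p, b) :: fo_answers s) (fo_clocks s)
    (fo_buffer s) (rcons (fo_out s) (MAnswer p b))).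
  by split=> //= x Hx; rewrite inE Hx orbT.
split=> //=.
- rewrite all_rcons /= inE eqxx /=; apply: sub_all iout => m; exact: justified_le.
- move=> p' q /iwait H /H[]; first by left.
  by move/(answered_le le); right.
- move=> q /isq H /H[]; first by left.
  by right; rewrite /sent_query has_rcons /= .
- move=> p'; rewrite inE /sent_answer has_rcons /= eq_sym => /orP[->|/isa[]].
  + by right.
  + by left.
  + by rewrite /sent_answer => ->; right; rewrite orbT.
Qed.

Lemma inv_store cs s : inv s -> inv (fo_store cs s).
Proof.
by rewrite /fo_store; case: ifP => // _ []; split.
Qed.

Lemma inv_conclude s e : inv s -> inv (fo_conclude s e).
Proof.
move=> H; elim/conclude_ind: (fo_conclude s e) => // p q s' _ [] *;
  by [|exact: inv_learn|exact: inv_store].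
Qed.

Lemma inv_saturate s : inv s -> inv (fo_saturate s).
Proof.
by move=> H; elim/saturate_ind: (fo_saturate s) => // s' e _ _; apply: inv_conclude.
Qed.

Lemma inv_expire s p : inv s -> inv (fo_expire s p).
Proof. by case: p => // -[] x p H; apply/inv_saturate/inv_learn. Qed.

Lemma inv_pose k q par s : query_weight q <= k -> may_pose i tbl G q par s ->
  inv s -> inv (fo_pose i tbl k q par s).
Proof.
move=> Hk Hq H; have der : derived_but i tbl [::] (fo_pose i tbl k q par s).
  by apply: fo_pose_derived; last exact: inv_derived H.
(* A single [pose1] may break [inv_derived] until the subquery is posed too, so the induction along
   the chain carries all clauses but that one. *)
pose inv' s := [/\ all (justified s) (fo_out s),
  forall q q', (q', Some q) \in fo_queries s ->
    [/\ known s q, ~~ is_truth_value q & derive i tbl q = Some q'],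
  (forall p c, (p, c) \in fo_clocks s -> [/\ quantified p, known s (QBool p) & C p c]) /\
  (forall p q, (QBool p, Some q) \in fo_queries s -> quantified p ->
    p \in unzip1 (fo_clocks s) \/ answered s p),
  (forall q, known s q -> ~~ is_truth_value q -> Q0 q \/ sent_query q (fo_out s)) /\
  (forall p, p \in unzip1 (fo_answers s) -> A0 p \/ sent_answer p (fo_out s)) &
  forall q, known s q -> G q].
suff [h1 h2 [h3 h4] [h5 h6] h7] : inv' (fo_pose i tbl k q par s) by split.
apply: (fo_pose_ind (i := i) (tbl := tbl) (G := G)) => //; last first.
  by case: H => *; split.
move=> {k Hk q par s Hq H der} q par s Hq [iout ient [iclk iwait] [isq isa] igood].
have le := pose1_le i q par s.
have Gq : G q.
  case: par Hq {le} => [q0|] Hq //; case: Hq => /igood Gq0 _ Hd.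
  exact: G_derive Hd.
split.
- rewrite pose1_out; have H1 : all (justified (pose1 i q par s)) (fo_out s).
    by apply: sub_all iout => m; exact: justified_le.
  by case: ifP => // _; rewrite all_rcons /= pose1_known eqxx.
- move=> q1 q2; rewrite pose1_queries => /orP[/eqP[-> Hp]|/ient[K1 H1 H2]].
    rewrite -{}Hp in Hq le *; case: Hq => K1 H1 H2; split=> //; exact: known_le le K1.
  split=> //; exact: known_le le K1.
- split.
    move=> p c; rewrite pose1_clocks.
    have old : (p, c) \in fo_clocks s ->
        [/\ quantified p, known (pose1 i q par s) (QBool p) & C p c].
      by move=> /iclk[? K ?]; split=> //; apply: known_le K.
    case: q Hq le Gq old => [xs cs p1|] // [] // Q x p1 Hq le Gq old.
    case: par Hq le old => // q0 Hq le old.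
    case: ifP => // _; rewrite inE => /orP[/eqP[-> ->]|//].
    by split; rewrite ?pose1_known ?eqxx.
  move=> p q0; rewrite pose1_queries => /orP[/eqP[Hp Hp']|].
    rewrite -{}Hp -{}Hp' in Hq le Gq *; case: p Hq le Gq => // Q x p Hq le Gq _; left.
    by rewrite pose1_clocks; case: ifP => //= _; rewrite inE eqxx.
  move=> /iwait H /H[Hc|]; last by move/(answered_le le); right.
  left; rewrite pose1_clocks.
  case: (q) => [xs cs p1|[b|s1 t|ts|s1 t|p1|p1 p2|p1 p2|Q x p1]] //.
  by case: (par) => // q1; case: ifP => // _ /=; rewrite inE Hc orbT.
- split; rewrite pose1_out.
    move=> q1; rewrite pose1_known; case: (eqVneq q1 q) => [->|q1q] /= K1 Ht.
      case: ifP => [|_].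
        by rewrite (negbTE Ht) orbF => /isq /(_ Ht).
      by right; rewrite /sent_query has_rcons eqxx.
    case: (isq q1 K1 Ht) => H1; [by left|right].
    by case: ifP => // _; rewrite /sent_query has_rcons; apply/orP; right.
  rewrite pose1_answers => p /isa[H1|H1]; [by left|right].
  by case: ifP => // _; rewrite /sent_answer has_rcons; apply/orP; right.
- by move=> q1; rewrite pose1_known => /orP[/eqP ->|/igood].
Qed.

Lemma receive_le s m : state_le s (fo_receive i tbl s m).
Proof.
case: m => /= [*|q|p b|]; by [exact: state_le_refl|exact: fo_pose_le|exact: learn_le].
Qed.

Lemma foldl_receive_le s ms : state_le s (foldl (fo_receive i tbl) s ms).
Proof.
elim: ms s => [|m ms IH] s /=; first exact: state_le_refl.
exact: state_le_trans (receive_le s m) (IH _).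
Qed.

Lemma expire_le s p : state_le s (fo_expire s p).
Proof.
case: p => [||||||| [] x p]; try by move=> *; exact: state_le_refl.
all: by apply: state_le_trans (learn_le _ _ _) (saturate_le _).
Qed.

Lemma foldl_expire_le s ps : state_le s (foldl (@fo_expire U l) s ps).
Proof.
elim: ps s => [|p ps IH] s /=; first exact: state_le_refl.
exact: state_le_trans (expire_le s p) (IH _).
Qed.

Lemma expire_answered s p : quantified p -> answered (fo_expire s p) p.
Proof.
case: p => // -[] x p _ /=; apply: answered_le (saturate_le _) _; exact: learn_answered.
Qed.

Lemma foldl_expire_answered s ps p : p \in ps -> quantified p ->
  answered (foldl (@fo_expire U l) s ps) p.
Proof.
elim: ps s => //= p' ps IH s; rewrite inE => /orP[/eqP ->|Hp] Hq; last exact: IH.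
by apply: answered_le (foldl_expire_le _ _) _; apply: expire_answered.
Qed.

Lemma expire_clocks s p : fo_clocks (fo_expire s p) = fo_clocks s.
Proof. by case: p => // -[] x p /=; rewrite saturate_clocks learn_clocks. Qed.

Lemma foldl_expire_clocks s ps : fo_clocks (foldl (@fo_expire U l) s ps) = fo_clocks s.
Proof. by elim: ps s => //= p ps IH s; rewrite IH expire_clocks. Qed.

Lemma expire_saturated s p : saturated s -> saturated (fo_expire s p).
Proof. by case: p => // -[] x p _; apply: saturate_saturated. Qed.

Lemma foldl_expire_saturated s ps : saturated s -> saturated (foldl (@fo_expire U l) s ps).
Proof. by elim: ps s => //= p ps IH s Hs; apply/IH/expire_saturated. Qed.

Lemma inv_foldl_receive s ms : (forall q, sent_query q ms -> G q) ->
  inv s -> inv (foldl (fo_receive i tbl) s ms).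
Proof.
elim: ms s => //= m ms IH s H Hs; apply: IH => [q Hq|].
  by apply: H; rewrite Hq orbT.
case: m H => //= [q H|p b _]; last exact: inv_learn.
by apply: inv_pose => //; [apply: query_weight_depth|apply: H; rewrite eqxx].
Qed.

Lemma inv_foldl_expire s ps : inv s -> inv (foldl (@fo_expire U l) s ps).
Proof. by elim: ps s => //= p ps IH s Hs; apply/IH/inv_expire. Qed.

Lemma foldl_receive_query s ms q : sent_query q ms ->
  known (foldl (fo_receive i tbl) s ms) q.
Proof.
elim: ms s => //= m ms IH s /orP[|/IH //].
case: m => // q' /eqP ->; apply: known_le (foldl_receive_le _ _) _.
by apply/mapP; exists (q, None) => //; apply: fo_pose_entry.
Qed.

Lemma foldl_receive_answer s ms p : sent_answer p ms ->
  answered (foldl (fo_receive i tbl) s ms) p.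
Proof.
elim: ms s => //= m ms IH s /orP[|/IH //].
case: m => // p' b /eqP ->; apply: answered_le (foldl_receive_le _ _) _.
exact: learn_answered.
Qed.

Definition tick s : fo_state :=
  FOState (fo_queries s) (fo_answers s) [seq (e.1, e.2.-1) | e <- fo_clocks s]
          (fo_buffer s) [::].
(** The state inside a round before any clock expires: an answer present here forestalls the default
    value. *)
Definition after_inbox (inbox : seq message) s : fo_state :=
  fo_saturate (foldl (fo_receive i tbl) (tick s) inbox).
Definition due s : seq formula := [seq e.1 | e <- fo_clocks s & e.2 == 0].
Definition sweep s : fo_state :=
  FOState (fo_queries s) (fo_answers s) [seq e <- fo_clocks s | e.2 != 0]
          (fo_buffer s) (fo_out s).

Lemma fo_roundE inbox s : fo_round i tbl inbox s =
  let s1 := after_inbox inbox s in sweep (foldl (@fo_expire U l) s1 (due s1)).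
Proof. by []. Qed.

Lemma tick_le s : state_le s (tick s). Proof. by split. Qed.
Lemma sweep_le s : state_le s (sweep s). Proof. by split. Qed.

Lemma after_inbox_le inbox s : state_le s (after_inbox inbox s).
Proof.
apply: state_le_trans (tick_le s) (state_le_trans (foldl_receive_le _ _) (saturate_le _)).
Qed.

Lemma round_after_inbox_le inbox s : state_le (after_inbox inbox s) (fo_round i tbl inbox s).
Proof. exact: state_le_trans (foldl_expire_le _ _) (sweep_le _). Qed.

Lemma fo_round_le inbox s : state_le s (fo_round i tbl inbox s).
Proof. exact: state_le_trans (after_inbox_le _ _) (round_after_inbox_le _ _). Qed.

Lemma saturated_sweep s : saturated s -> saturated (sweep s).
Proof.
move=> Hs e /Hs; case: e => -[xs cs p|p] [par|] //=.
rewrite /fo_answer /=; rewrite -/(fo_answer s p).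
case: fo_answer => // b; case: par => [xs cs r|r].
  (* If [cs] were absent, saturation would equate the buffer with a list longer by one. *)
  case: b => //; rewrite /fo_store /=; case: ifP => // _ /(congr1 (@fo_buffer U l)) /= H.
  by move/(congr1 size): H => /=; lia.
have L c : fo_learn r c s = s -> fo_learn r c (sweep s) = sweep s.
  move=> <-; apply: learn_id.
  by have := learn_answered r c s; rewrite !answeredE.
case: r L => [c|s1 t|ts|s1 t|r|r1 r2|r1 r2|[] x r] L; try exact: L.
  by case: b => // /L.
by case: b => // /L.
Qed.

Lemma fo_round_saturated inbox s : saturated (fo_round i tbl inbox s).
Proof.
by rewrite fo_roundE; apply/saturated_sweep/foldl_expire_saturated/saturate_saturated.
Qed.

Lemma foldl_receive_clocks s ms p c : (p, c) \in fo_clocks s ->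
  (p, c) \in fo_clocks (foldl (fo_receive i tbl) s ms).
Proof.
elim: ms s => //= m ms IH s H; apply: IH.
case: m => //= [q|r b]; last by rewrite learn_clocks.
apply: (fo_pose_ind (G := fun _ => True) (P := fun s => (p, c) \in fo_clocks s))
  => // q1 par s1 _ H1.
rewrite pose1_clocks; case: q1 => [xs cs p1|[b|s2 t|ts|s2 t|p1|p1 p2|p1 p2|Q x p1]] //.
by case: par => // q1; case: ifP => // _; rewrite inE H1 orbT.
Qed.

(** Testing [c.-1] covers [c = 0]: such a clock expires in the next round, like one set to 1. *)
Lemma fo_round_clock inbox s p c : (p, c) \in fo_clocks s -> quantified p ->
  if c.-1 == 0 then answered (fo_round i tbl inbox s) p
  else (p, c.-1) \in fo_clocks (fo_round i tbl inbox s).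
Proof.
move=> Hc Hp; rewrite fo_roundE /=; set s1 := after_inbox _ _.
have Hc1 : (p, c.-1) \in fo_clocks s1.
  rewrite /s1 /after_inbox saturate_clocks; apply: foldl_receive_clocks.
  by apply/mapP; exists (p, c).
case: ifP => c0.
  apply: answered_le (sweep_le _) _; apply: foldl_expire_answered => //.
  by apply/mapP; exists (p, c.-1); rewrite ?mem_filter /= ?c0.
by rewrite mem_filter /= c0 foldl_expire_clocks.
Qed.

End NodeInvariant.

Section Round.

Variables (U : eqType) (l : nat) (i : local_info U) (tbl : table U).
Variables (Q0 : pred (query U l)) (A0 : pred (formula U l)) (G : query U l -> Prop).
Variables (C0 C1 C2 : formula U l -> nat -> Prop) (s : fo_state U l).
Variable inbox : seq (message U l).
Hypothesis G_derive : forall q q', G q -> derive i tbl q = Some q' -> G q'.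
Hypothesis C1_init : forall p, C1 p (2 * net_diam i * nb_symbols p).
Hypothesis C01 : forall p c, C0 p c -> C1 p c.-1.
Hypothesis inbox_good : forall q, sent_query q inbox -> G q.
Hypothesis s_inv : node_inv i tbl Q0 A0 C0 G s.

Let Q1 : pred (query U l) := known s.
Let A1 : pred (formula U l) := fun p => p \in unzip1 (fo_answers s).

Lemma inv_received :
  node_inv i tbl Q1 A1 C1 G (foldl (fo_receive i tbl) (tick s) inbox).
Proof.
apply: inv_foldl_receive => //.
case: s_inv => iout ient iclk iwait isq isa igood ider; split=> //=.
- by move=> p _ /mapP[[p' c] /iclk[? ? ?] [-> ->]]; split=> //; apply: C01.
- move=> p q /iwait H /H[Hc|Ha]; last by right; apply: answered_le (tick_le s) Ha.
  by left; rewrite /unzip1 -map_comp.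
- by move=> q H _; left.
- by move=> p; left.
Qed.

Lemma inv_after_inbox : node_inv i tbl Q1 A1 C1 G (after_inbox i tbl inbox s).
Proof. exact/inv_saturate/inv_received. Qed.

(** [C0], [C1] and [C2] describe the clocks before, during and after the round; the clocks that
    survive it are nonzero, and this may be used to pass from [C1] to [C2]. *)
Lemma inv_round :
  (forall p c, quantified p -> known (fo_round i tbl inbox s) (QBool p) -> c != 0 ->
    C1 p c -> C2 p c) ->
  node_inv i tbl Q1 A1 C2 G (fo_round i tbl inbox s).
Proof.
move=> C12; have := inv_foldl_expire (due (after_inbox i tbl inbox s)) inv_after_inbox.
rewrite fo_roundE /= in C12 *; set s1 := after_inbox _ _ _ _ in C12 *.
set s2 := foldl _ _ _ in C12 *.
case=> iout ient iclk iwait isq isa igood ider; split=> //=.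
- by move=> p c; rewrite mem_filter => /andP[c0 /iclk[? K ?]]; split=> //; apply: C12.
- move=> p q /iwait H Hp; case: (H Hp) => [/mapP[[p' c] Hc /= Hp']|]; last first.
    by right; apply: answered_le (sweep_le _) _.
  rewrite -{p'}Hp' in Hc; case: (eqVneq c 0) => c0; last first.
    by left; apply/mapP; exists (p, c); rewrite ?mem_filter ?c0.
  right; apply: answered_le (sweep_le _) _; apply: foldl_expire_answered => //.
  apply/mapP; exists (p, c) => //; rewrite mem_filter c0 /=.
  by move: Hc; rewrite foldl_expire_clocks c0.
Qed.

End Round.

(** * The first-order engine on a network *)

Lemma ohead_tuple (T : Type) n (a : n.+1.-tuple T) : ohead a = Some (thead a).
Proof. by case/tupleP: a => x a. Qed.

Section FirstOrder.

Variables (U : eqType) (l : nat) (V : seq U) (E : rel U).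
Hypothesis V_neq0 : V != [::].
Hypothesis E_V : forall u v, E u v -> (u \in V) && (v \in V).
Hypothesis E_sym : symmetric E.
Let Delta := diam V E.
Hypothesis walk_diam : {in V &, forall u v, walk V E Delta u v}.

Variables (F : fpformula U l) (J : pred (l.+1.-tuple U)).
Hypothesis F_consts : {subset consts (fp_body F) <= V}.

Notation formula := (formula U l).
Notation query := (query U l).
Notation message := (message U l).
Notation fo_state := (fo_state U l).
Implicit Types (p r : formula) (q : query) (s : fo_state) (u v : U) (b : bool) (t : nat).

Definition table_of v (tb : table U) : Prop :=
  forall cs, cs \in tb <-> exists a : l.+1.-tuple U, [/\ cs = a, thead a = v & J a].

Lemma sat_simplify e v tb p : table_of v tb ->
  sat V E J e (simplify (info_of V E v) tb p) = sat V E J e p.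
Proof.
move=> Htb.
have nb u : (u \in [seq u <- V | E v u]) = E v u.
  by rewrite mem_filter andb_idr // => /E_V /andP[].
elim: p e => [b|s t|ts|s t|p IH|p IHp q IHq|p IHp q IHq|Q x p IH] e //.
- case: s t => [x|a] [y|b] //=; case: eqVneq => [->|av] /=; first by rewrite nb.
  by case: eqVneq => [->|bv] //=; rewrite nb E_sym.
- rewrite [simplify _ _ _]/=; set cs := flatten _.
  case: ifP => // /andP[/eqP sz /eqP hd] /=.
  have Hm : map (term_val e) ts = cs by apply: map_term_val_consts; rewrite size_tuple.
  apply/idP/idP => [/Htb[a [csa _]]|Ja]; first by congr (J _); apply: val_inj; rewrite /= Hm.
  apply/Htb; exists [tuple of map (term_val e) ts]; split=> //.
  by move: hd; rewrite -Hm (ohead_tuple [tuple of map _ ts]) => -[].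
- by case: s t => [x|a] [y|b].
- by case: simplify_notP (IH e) => [b ->|_] /= => <-.
- case: simplify_andP (IHp e) (IHq e) => [->|->|->|->|_ _] /= => <- <- //;
    by rewrite ?andbT ?andbF.
- case: simplify_orP (IHp e) (IHq e) => [->|->|->|->|_ _] /= => <- <- //;
    by rewrite ?orbT ?orbF.
- by case: Q => /=; [apply: eq_has|apply: eq_all] => a; rewrite IH.
Qed.

(* Any atom will do: the node named by its first constant decides it. *)
Lemma simplifying_node p : atoms_only p -> free_vars p = [::] ->
  {subset consts p <= V} ->
  exists2 v, v \in V & forall tb, nb_symbols (simplify (info_of V E v) tb p) < nb_symbols p.
Proof.
elim: p => // [s t|ts|s t|p IH|p IHp q IHq|p IHp q IHq].
- case: s t => [x|a] [y|b] //= _ _ sub; exists a; first by apply: sub; rewrite inE eqxx.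
  by rewrite eqxx.
- rewrite /= => _ /closed_terms_consts; set cs := flatten _; rewrite size_tuple => sz sub.
  case Hcs: cs sz => [//|a cs'] /= sz; exists a; first by apply: sub; rewrite Hcs inE eqxx.
  by move=> tb; rewrite sz !eqxx.
- case: s t => [x|a] [y|b] //= _ _ sub; exists a; first by apply: sub; rewrite inE eqxx.
  by [].
- move=> ap fp sub; case: (IH ap fp sub) => v vV H; exists v => // tb.
  by move: (H tb); case: simplify_notP => /=; lia.
- move=> /andP[ap aq] /eqP; rewrite -size_eq0 size_cat addn_eq0 !size_eq0.
  move=> /andP[/eqP fp _] sub.
  case: IHp => [//|//|c Hc|v vV H]; first by apply: sub; rewrite mem_cat Hc.
  exists v => // tb; have := H tb; have := nb_symbols_simplify (info_of V E v) tb q.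
  by case: simplify_andP => /=; lia.
- move=> /andP[ap aq] /eqP; rewrite -size_eq0 size_cat addn_eq0 !size_eq0.
  move=> /andP[/eqP fp _] sub.
  case: IHp => [//|//|c Hc|v vV H]; first by apply: sub; rewrite mem_cat Hc.
  exists v => // tb; have := H tb; have := nb_symbols_simplify (info_of V E v) tb q.
  by case: simplify_orP => /=; lia.
Qed.

Let body := prenex (fp_vars F) (fp_body F).

Definition good_formula (xs : seq nat) p : Prop :=
  [/\ reduced p, {subset free_vars p <= xs}, {subset consts p <= V} &
      nb_symbols p <= nb_symbols (fp_body F)].

(** For an open query, [zs] are the listed variables already instantiated by [cs]. Comparing with
    [body] only under valuations that send [zs] to [cs] is enough: when no variable is left, this
    yields membership in [fp_op]. *)
Definition good_query q : Prop :=
  match q with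
  | QBool p => good_formula [::] p
  | QOpen xs cs p =>
      [/\ good_formula xs p, {subset cs <= V} &
          exists zs, [/\ tval (fp_vars F) = xs ++ zs, size zs = size cs &
            forall e, map e zs = cs -> sat V E J e p = sat V E J e body]]
  end.

Section Tables.

Variable tbl : U -> table U.
Hypothesis tbl_ok : {in V, forall v, table_of v (tbl v)}.

Notation info := (info_of V E).
Notation derive v := (derive (info v) (tbl v)).
Notation simplify v := (simplify (info v) (tbl v)).

Lemma good_instance v xs x p : v \in V -> is_prenex p ->
  {subset free_vars p <= rcons xs x} -> {subset consts p <= V} ->
  nb_symbols p <= nb_symbols (fp_body F) ->
  good_formula xs (simplify v (subst x v p)).
Proof.
move=> vV rp fp cp np; split.
- by apply: reduced_simplify; rewrite is_prenex_subst.
- move=> y /free_vars_simplify; rewrite free_vars_subst mem_filter => /andP[yx /fp].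
  by rewrite mem_rcons inE (negbTE yx).
- by move=> c /consts_simplify/consts_subst; rewrite inE => /orP[/eqP ->|/cp].
- by apply: leq_trans (nb_symbols_simplify _ _ _) _; rewrite nb_symbols_subst.
Qed.

Lemma sat_instance v x p e : v \in V ->
  sat V E J e (simplify v (subst x v p)) = sat V E J (upd e x v) p.
Proof. by move=> vV; rewrite sat_simplify ?sat_subst //; apply: tbl_ok. Qed.

(** A valuation that already sends [x] to [v] is unchanged by the update at [x]. *)
Lemma sat_open_instance v x zs p cs : v \in V ->
  (forall e, map e zs = cs -> sat V E J e p = sat V E J e body) ->
  forall e, map e (x :: zs) = v :: cs ->
    sat V E J e (simplify v (subst x v p)) = sat V E J e body.
Proof.
move=> vV H e [ex /H <-]; rewrite sat_instance //; apply: sat_ext => y _.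
by rewrite /upd; case: eqP => // ->.
Qed.

Lemma good_derive v q q' : v \in V -> good_query q -> derive v q = Some q' ->
  good_query q'.
Proof.
move=> vV; case: q => [[|x xs] cs p|p].
- by case=> gp _ _ /=; case: eqP => // _ [<-].
- move=> + [<-]; rewrite /good_query lastI => -[[rp fp cp np] csV [zs [Hzs sz Hs]]].
  split.
  + by apply: good_instance => //; apply: reduced_prenex.
  + by move=> c; rewrite inE => /orP[/eqP ->|/csV].
  + exists (last x xs :: zs); split; [by rewrite Hzs cat_rcons|by rewrite /= sz|].
    exact: sat_open_instance.
- move=> gp; have H : Some (QBool (simplify v p)) = Some q' -> quantifier_free p ->
      good_query q'.
    case=> <- qp; case: gp => rp fp cp np; split.
    + by apply: reduced_simplify; apply: reduced_prenex.
    + by move=> x /free_vars_simplify/fp.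
    + by move=> x /consts_simplify/cp.
    + exact: leq_trans (nb_symbols_simplify _ _ _) np.
  case: p gp H => [b|s1 t|ts|s1 t|p|p1 p2|p1 p2|Q x p] gp H;
    try by rewrite [derive _ _]/=; case: ifP => // _ /H; apply; case: gp => /reduced_prenex.
  move=> /= {H} [<-]; case: gp => rp fp cp np; apply: good_instance => //.
  + by apply: reduced_prenex.
  + move=> y Hy; rewrite inE; case: (eqVneq y x) => // yx.
    by have := fp y; rewrite /= mem_filter yx Hy => /(_ isT).
  + exact: ltnW np.
Qed.

Definition start_query v : query :=
  QOpen (belast (thead (fp_vars F)) (behead (fp_vars F))) [:: v]
    (simplify v (subst (last (thead (fp_vars F)) (behead (fp_vars F))) v body)).

Lemma fo_startE v : fo_start (info v) (tbl v) F =
  fo_saturate (fo_pose (info v) (tbl v) (query_depth (start_query v)) (start_query v)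
    None (fo_init U l)).
Proof. by []. Qed.

Lemma start_vars : tval (fp_vars F) =
  rcons (belast (thead (fp_vars F)) (behead (fp_vars F)))
        (last (thead (fp_vars F)) (behead (fp_vars F))).
Proof. by rewrite -lastI {1}(tuple_eta (fp_vars F)). Qed.

Lemma good_start v : v \in V -> good_query (start_query v).
Proof.
move=> vV; split.
- apply: good_instance => //.
  + exact: (is_prenex_prenex V_neq0).
  + by rewrite -start_vars; apply: (free_vars_prenex V_neq0); apply: fp_vars_free.
  + by move=> c /(consts_prenex V_neq0)/F_consts.
  + by rewrite (nb_symbols_prenex V_neq0).
- by move=> c; rewrite inE => /eqP ->.
- exists [:: last (thead (fp_vars F)) (behead (fp_vars F))]; split=> //.
    by rewrite cats1 -start_vars.
  by apply: sat_open_instance => // e; rewrite map_nil.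
Qed.

Variable extra : U -> seq message.
Hypothesis extra_inform : forall v, all (@is_inform U l) (extra v).

(* The messages [extra] are those of the preceding phase that arrive in the
   first round of the evaluation. *)
Fixpoint fo_run (t : nat) (v : U) : fo_state :=
  if t is t'.+1 then
    fo_round (info v) (tbl v)
      (flatten [seq (if t' == 0 then extra u else [::]) ++ fo_out (fo_run t' u)
               | u <- V & E u v]) (fo_run t' v)
  else fo_start (info v) (tbl v) F.

Definition fo_inbox t v : seq message :=
  flatten [seq (if t == 0 then extra u else [::]) ++ fo_out (fo_run t u) | u <- V & E u v].

Lemma fo_runS t v :
  fo_run t.+1 v = fo_round (info v) (tbl v) (fo_inbox t v) (fo_run t v).
Proof. by []. Qed.

Lemma has_fo_inbox (P : pred message) t v : (forall m, is_inform m -> ~~ P m) ->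
  has P (fo_inbox t v) = has (fun u => E u v && has P (fo_out (fo_run t u))) V.
Proof.
move=> HP; rewrite /fo_inbox; elim: V => //= u W IH; case: ifP => /= Euv; last exact: IH.
rewrite has_cat IH; congr (_ || _); case: ifP => // _; rewrite has_cat.
suff /negbTE -> : ~~ has P (extra u) by [].
by rewrite -all_predC; apply: sub_all (extra_inform u).
Qed.

Lemma sent_query_inbox q t v :
  sent_query q (fo_inbox t v) = has (fun u => E u v && sent_query q (fo_out (fo_run t u))) V.
Proof. by apply: has_fo_inbox; case. Qed.

Lemma sent_answer_inbox p t v :
  sent_answer p (fo_inbox t v) = has (fun u => E u v && sent_answer p (fo_out (fo_run t u))) V.
Proof. by apply: has_fo_inbox; case. Qed.

Lemma justified_query s q : all (justified s) (fo_out s) -> sent_query q (fo_out s) ->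
  known s q.
Proof.
elim: (fo_out s) => //= m ms IH /andP[Hm /IH H] /orP[|//].
by case: m Hm => // q' ? /eqP <-.
Qed.

(* In a one-node network all clocks are 0 from the start and say nothing about
   the round in which they were set. *)
Definition clock_inv t v p c : Prop :=
  c <= 2 * Delta * nb_symbols p /\
  (0 < Delta -> 0 < c /\ exists t0, [/\ t0 <= t, t0 + 2 * Delta * nb_symbols p = t + c &
     known (fo_run t0 v) (QBool p)]).

(** The counterpart of [clock_inv] inside round [t.+1]: a clock may have been set in this very
    round, and one that is due has value 0. *)
Definition clock_inv_in t v p c : Prop :=
  c <= 2 * Delta * nb_symbols p /\
  (0 < Delta -> exists t0, t0 + 2 * Delta * nb_symbols p = t.+1 + c /\
    (t0 = t.+1 \/ t0 <= t /\ known (fo_run t0 v) (QBool p))).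

(** Nothing is known before round 0, so whatever the start creates must be among its outgoing
    messages. *)
Definition known_before t v : pred query :=
  fun q => if t is t'.+1 then known (fo_run t' v) q else false.
Definition answered_before t v : pred formula :=
  fun p => if t is t'.+1 then p \in unzip1 (fo_answers (fo_run t' v)) else false.

Lemma quantified_nb p : quantified p -> 0 < nb_symbols p. Proof. by case: p. Qed.

Lemma fo_run_inv t v : v \in V ->
  node_inv (info v) (tbl v) (known_before t v) (answered_before t v) (clock_inv t v)
    good_query (fo_run t v).
Proof.
elim: t v => [|t IH] v vV.
  rewrite [fo_run 0 v]fo_startE; apply: inv_saturate.
  set s := fo_pose _ _ _ _ _ _.
  have : node_inv (info v) (tbl v) (known_before 0 v) (answered_before 0 v)
      (fun p c => c = 2 * Delta * nb_symbols p) good_query s.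
    apply: inv_pose => //.
    - by move=> q q'; apply: good_derive.
    - exact: query_weight_depth.
    - exact: good_start.
  case=> iout ient iclk iwait isq isa igood ider; split=> // p c /iclk[qp K ->].
  split=> //; split=> // D0; have := quantified_nb qp; split; first by rewrite !muln_gt0 D0.
  exists 0; split=> //; apply: known_le (saturate_le _) K.
rewrite fo_runS; apply: (inv_round (C1 := clock_inv_in t v)) (IH v vV) _.
- by move=> q q'; apply: good_derive.
- by move=> p; split=> // D0; exists t.+1; split=> //; left.
- move=> p c [le1 H]; split; first by lia.
  move=> D0; case: (H D0) => c0 [t0 [le0 eq0 K0]]; exists t0; split; first by lia.
  by right.
- move=> q; rewrite sent_query_inbox => /hasP[u uV /andP[_ Hq]].
  have [iout _ _ _ _ _ igood _] := IH u uV.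
  by apply: igood; apply: justified_query iout Hq.
- move=> p c qp K c0 [le1 H]; split=> // D0; split; first by rewrite lt0n.
  case: (H D0) => t0 [eq0 [t0t|[t0t K0]]]; exists t0; split; rewrite ?t0t //; try lia.
Qed.

Lemma fo_received_inv t v : v \in V ->
  node_inv (info v) (tbl v) (known_before t.+1 v) (answered_before t.+1 v)
    (clock_inv_in t v) good_query
    (foldl (fo_receive (info v) (tbl v)) (tick (fo_run t v)) (fo_inbox t v)).
Proof.
move=> vV; apply: inv_received (fo_run_inv t vV).
- by move=> q q'; apply: good_derive.
- by move=> p; split=> // D0; exists t.+1; split=> //; left.
- move=> p c [le1 H]; split; first by lia.
  move=> D0; case: (H D0) => c0 [t0 [le0 eq0 K0]]; exists t0; split; first by lia.
  by right.
- move=> q; rewrite sent_query_inbox => /hasP[u uV /andP[_ Hq]].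
  have [iout _ _ _ _ _ igood _] := fo_run_inv t uV.
  by apply: igood; apply: justified_query iout Hq.
Qed.

Definition fo_mid t v : fo_state := after_inbox (info v) (tbl v) (fo_inbox t v) (fo_run t v).

Lemma fo_mid_inv t v : v \in V ->
  node_inv (info v) (tbl v) (known_before t.+1 v) (answered_before t.+1 v)
    (clock_inv_in t v) good_query (fo_mid t v).
Proof. by move=> vV; apply/inv_saturate/fo_received_inv. Qed.

(** * Travel times of queries and answers, and deadlines *)

Lemma fo_run_le t t' v : t <= t' -> state_le (fo_run t v) (fo_run t' v).
Proof.
move=> /subnK <-; elim: (t' - t) => [|k IH]; first exact: state_le_refl.
by rewrite addSn; apply: state_le_trans IH (fo_round_le _ _ _ _).
Qed.

Lemma fo_mid_le t v : state_le (fo_mid t v) (fo_run t.+1 v).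
Proof. exact: round_after_inbox_le. Qed.

Lemma fo_run_saturated t v : saturated (fo_run t v).
Proof. by case: t => [|t]; [apply: saturate_saturated|apply: fo_round_saturated]. Qed.

(** A query known at [u] is either being broadcast in round [t] or was already known in the
    preceding round, where induction applies. *)
Lemma known_edge t u v q : E u v -> ~~ is_truth_value q ->
  known (fo_run t u) q -> known (fo_run t.+1 v) q.
Proof.
move=> Euv Hq; have /andP[uV vV] := E_V Euv.
elim: t => [|t IH] K; case: (inv_sent_query (fo_run_inv _ uV) K Hq) => // H.
1,3: rewrite fo_runS; apply: known_le (round_after_inbox_le _ _ _ _) _;
  apply: known_le (saturate_le _) _; apply: foldl_receive_query;
  rewrite sent_query_inbox; by apply/hasP; exists u; rewrite ?Euv.
by apply: known_le (IH H); apply: fo_run_le.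
Qed.

Lemma known_walk k t u v q : u \in V -> ~~ is_truth_value q -> walk V E k u v ->
  known (fo_run t u) q -> known (fo_run (t + k) v) q.
Proof.
move=> + Hq; elim: k t u => [|k IH] t u uV; first by move=> /eqP ->; rewrite addn0.
case/orP => [/eqP ->|/hasP[z zV /andP[Euz W]]] K.
  by apply: known_le K; apply: fo_run_le; lia.
by rewrite addnS -addSn; apply: IH W _ => //; apply: known_edge Euz _ K.
Qed.

(** The conclusion is about [fo_mid t v], which is stronger than [fo_run t.+1 v]: the answer is
    there before the clocks of round [t.+1] expire. This decides the case of an answer that arrives
    exactly at the deadline. *)
Lemma answered_edge t u v p : E u v -> answered (fo_run t u) p -> answered (fo_mid t v) p.
Proof.
move=> Euv; have /andP[uV vV] := E_V Euv.
rewrite [answered (fo_run _ _) _]answeredE => /orP[|A]; first by rewrite answeredE => ->.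
have step t' : sent_answer p (fo_out (fo_run t' u)) -> answered (fo_mid t' v) p.
  move=> H; apply: answered_le (saturate_le _) _; apply: foldl_receive_answer.
  by rewrite sent_answer_inbox; apply/hasP; exists u; rewrite ?Euv.
elim: t A => [|t IH] A; case: (inv_sent_answer (fo_run_inv _ uV) A) => // H; try exact: step.
by apply: answered_le (IH H); apply: state_le_trans (fo_mid_le _ _) (after_inbox_le _ _ _ _).
Qed.

Lemma answered_mid_walk k t u v p : walk V E k.+1 u v ->
  answered (fo_run t u) p -> answered (fo_mid (t + k) v) p.
Proof.
elim: k t u => [|k IH] t u /orP[/eqP ->|/hasP[z zV /andP[Euz W]]] A.
1,3: apply: answered_le A;
  by apply: state_le_trans (fo_run_le _ _) (after_inbox_le _ _ _ _); lia.
- by move/eqP: W Euz => <- Euz; rewrite addn0; apply: answered_edge Euz A.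
- rewrite addnS -addSn; apply: IH W _.
  by apply: answered_le (fo_mid_le _ _) _; apply: answered_edge Euz A.
Qed.

Lemma answered_walk k t u v p : walk V E k u v ->
  answered (fo_run t u) p -> answered (fo_run (t + k) v) p.
Proof.
case: k => [/eqP ->|k W A]; first by rewrite addn0.
by rewrite addnS; apply: answered_le (fo_mid_le _ _) _; apply: answered_mid_walk W A.
Qed.

Lemma clock_answered t v p c t' : (p, c) \in fo_clocks (fo_run t v) -> quantified p ->
  t + c <= t' -> t < t' -> answered (fo_run t' v) p.
Proof.
move=> Hc Hp; elim: c t t' Hc => [|c IH] t t' Hc le1 lt1;
  have := fo_round_clock (info v) (tbl v) (fo_inbox t v) Hc Hp; rewrite -fo_runS [_.-1]/=.
  by rewrite eqxx; apply: answered_le; apply: fo_run_le.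
case: ifP => c0.
  by apply: answered_le; apply: fo_run_le.
by move=> Hc'; apply: IH Hc' _ _; lia.
Qed.

Lemma subquery_posed t v q q' : v \in V -> known (fo_run t v) q -> ~~ is_truth_value q ->
  derive v q = Some q' -> (q', Some q) \in fo_queries (fo_run t v).
Proof. by move=> vV K Hq Hd; apply: (inv_derived (fo_run_inv t vV)). Qed.

Lemma entry_known s q par : (q, par) \in fo_queries s -> known s q.
Proof. by move=> H; apply/mapP; exists (q, par). Qed.

Lemma subquery_answered t v p q t' : v \in V -> quantified p ->
  (QBool p, Some q) \in fo_queries (fo_run t v) ->
  t + 2 * Delta * nb_symbols p <= t' -> t < t' -> answered (fo_run t' v) p.
Proof.
move=> vV Hp He le1 lt1; have inv := fo_run_inv t vV.
case: (inv_wait inv He Hp) => [/mapP[[p' c] Hc /= pp]|].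
  rewrite -{p'}pp in Hc; have [_ _ [le2 _]] := inv_clock inv Hc.
  by apply: clock_answered Hc _ _ lt1 => //; lia.
by apply: answered_le; apply: fo_run_le; apply: ltnW.
Qed.

(** The budget of one symbol: [d] rounds for the query to travel out and [d] for the answer to
    return, around the time spent on a subquery with fewer symbols. *)
Lemma clock_step t d n n' : n' < n -> t + d + 2 * d * n' + d <= t + 2 * d * n.
Proof.
move=> lt; have : 2 * d * n'.+1 <= 2 * d * n by rewrite leq_mul2l lt orbT.
by rewrite mulnS; lia.
Qed.

(** Induction on the number of symbols. No clock is involved and either value of the simplified
    query settles its parent, so this bound can be proved before any soundness is known. *)
Lemma quantifier_free_answered p v t : v \in V -> known (fo_run t v) (QBool p) ->
  ~~ quantified p -> answered (fo_run (t + 2 * Delta * nb_symbols p) v) p.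
Proof.
have [n] := ubnP (nb_symbols p); elim: n p v t => // n IH p v t np vV K Hp.
case pB: (is_truth_value (QBool p)); first by case: p pB {np K Hp}.
have [rp fp cp _] := inv_good (fo_run_inv t vV) K.
have ap : atoms_only p by case: p pB rp Hp {np K fp cp}.
have f0 : free_vars p = [::].
  by case: (free_vars p) fp => // x xs /(_ x); rewrite inE eqxx => /(_ isT).
case: (simplifying_node ap f0 cp) => b bV /(_ (tbl b)) Hb.
have Kb : known (fo_run (t + Delta) b) (QBool p).
  by apply: known_walk K; rewrite ?pB ?walk_diam.
have Hd : derive b (QBool p) = Some (QBool (simplify b p)).
  have -> : derive b (QBool p) =
      if simplify b p == p then None else Some (QBool (simplify b p)).
    by case: p Hp {np K rp fp cp ap f0 pB Hb Kb}.
  by case: eqP Hb => // ->; rewrite ltnn.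
have He := subquery_posed bV Kb (negbT pB) Hd.
have Hq : ~~ quantified (simplify b p).
  have /andP[] := quantifier_free_simplify (info b) (tbl b) (atoms_only_qf ap).
  by case: (simplify b p).
have A : answered (fo_run (t + Delta + 2 * Delta * nb_symbols (simplify b p)) b) (simplify b p).
  by apply: IH (entry_known He) Hq; first exact: leq_trans Hb _.
have Ap : answered (fo_run (t + Delta + 2 * Delta * nb_symbols (simplify b p)) b) p.
  have [c Hc] := answeredP A.
  have [sub _ _] :=
    fo_run_le b (leq_addr (2 * Delta * nb_symbols (simplify b p)) (t + Delta)).
  apply: (saturated_answered (@fo_run_saturated _ _) (sub _ He) Hc).
  by case: p Hp {np K rp fp cp ap f0 pB Hb Kb Hd He Hq A Hc sub}.
apply: answered_le (answered_walk (walk_diam bV vV) Ap); apply: fo_run_le.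
exact: clock_step.
Qed.

(** * Soundness and completeness of an evaluation *)

Variable x0 : U.
(** Circulating Boolean queries are closed, so an arbitrary constant valuation serves. *)
Definition truth p : bool := sat V E J (fun _ => x0) p.

Definition sound v s : Prop :=
  (forall p b, (p, b) \in fo_answers s -> b = truth p) /\
  (forall cs, cs \in fo_buffer s ->
    exists a : l.+1.-tuple U, [/\ cs = a, thead a = v & fp_op V E F J a]).

Lemma sound_answer v s p b : sound v s -> fo_answer s p = Some b -> b = truth p.
Proof. by case=> H _ /fo_answer_mem[->|/H]. Qed.

Lemma truth_instance v x p : v \in V ->
  truth (simplify v (subst x v p)) = sat V E J (upd (fun _ => x0) x v) p.
Proof. exact: sat_instance. Qed.

Lemma map_assign (xs : l.+1.-tuple nat) (a : l.+1.-tuple U) : uniq xs ->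
  map (assign xs a) xs = a.
Proof.
move=> uxs; apply: (@eq_from_nth _ (thead a)); rewrite size_map !size_tuple // => j lj.
by rewrite (nth_map 0) ?size_tuple // /assign index_uniq ?size_tuple.
Qed.

Lemma truth_open (a : l.+1.-tuple U) p : good_query (QOpen [::] a p) ->
  truth p = fp_op V E F J a.
Proof.
case=> -[_ fp _ _] aV [zs [Hzs _ Hs]]; rewrite /= in Hzs; subst zs.
rewrite /fp_op; have -> : all (mem V) a by apply/allP.
rewrite -(sat_prenex V_neq0 _ _ _ (@fp_vars_free _ _ F)) -Hs; last first.
  exact/map_assign/fp_vars_uniq.
by apply: sat_ext => x /fp.
Qed.

Lemma sound_learn v p b s : sound v s -> answered s p \/ b = truth p ->
  sound v (fo_learn p b s).
Proof.
rewrite /fo_learn /answered => -[H1 H2]; case: fo_answer => // -[//|Hb]; split=> //= r c.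
by rewrite inE => /orP[/eqP[-> ->]|/H1].
Qed.

Section NodeSound.

Variables (v : U) (Q0 : pred query) (A0 : pred formula) (C : formula -> nat -> Prop).
Hypothesis vV : v \in V.
Notation inv := (node_inv (info v) (tbl v) Q0 A0 C good_query).

Lemma sound_conclude s e : inv s -> e \in fo_queries s -> sound v s ->
  sound v (fo_conclude s e).
Proof.
move=> Hinv He Hs; case: e He => -[xs cs r|p] [q|] // /(inv_entry Hinv)[Kq _ Hd].
case: (concludeP s p q) Kq Hd => [q0|x r Hp|x r Hp|r b Hr Hp|xs cs r Hp] Kq Hd //.
- apply: sound_learn => //; right; have := sound_answer Hs Hp; case: Hd => <-.
  by rewrite truth_instance // => Hv; apply/esym/hasP; exists v.
- apply: sound_learn => //; right; have := sound_answer Hs Hp; case: Hd => <-.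
  rewrite truth_instance // => Hv; apply/esym/negbTE; rewrite -has_predC.
  by apply/hasP; exists v => //=; apply/negbT/esym.
- apply: sound_learn => //; right; rewrite (sound_answer Hs Hp).
  have Hd' : Some (QBool (simplify v r)) = Some (QBool p).
    have : (if simplify v r == r then None else Some (QBool (simplify v r))) =
        Some (QBool p) by case: r Hr Hd {Kq Hp}.
    by case: ifP.
  by case: Hd' => <-; rewrite /truth sat_simplify //; apply: tbl_ok.
- case: xs Kq Hd => [|x xs] Kq /=; last by [].
  have Gq := inv_good Hinv Kq; case: eqP => // Hcs [rp]; rewrite rp in Gq.
  case: Hs => H1 H2; rewrite /fo_store; case: ifP => // _; split=> //= cs'.
  rewrite inE => /orP[/eqP ->|/H2 //].
  have scs : size cs == l.+1.
    by case: Gq => _ _ [zs [Hzs <- _]]; rewrite -[zs]/([::] ++ zs) -Hzs size_tuple.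
  exists (Tuple scs); split=> //.
    by move: Hcs; rewrite -[cs]/(tval (Tuple scs)) ohead_tuple => -[].
  by rewrite -(truth_open (a := Tuple scs) Gq) -(sound_answer (conj H1 H2) Hp).
Qed.

Lemma sound_saturate s : inv s -> sound v s -> sound v (fo_saturate s).
Proof.
move=> Hinv Hs.
suff [] : sound v (fo_saturate s) /\ inv (fo_saturate s) by [].
elim/saturate_ind: (fo_saturate s) => // s' e Hq He [S I]; split.
  by apply: sound_conclude => //; rewrite Hq.
exact: inv_conclude.
Qed.

Lemma sound_pose k q par s : sound v s -> sound v (fo_pose (info v) (tbl v) k q par s).
Proof.
elim: k q par s => [|k IH] q par s Hs; rewrite fo_poseE.
all: have Hs1 : sound v (pose1 (info v) q par s)
  by case: Hs => H1 H2; split; rewrite ?pose1_answers ?pose1_buffer.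
  by case: ifP.
by case: ifP => // _; case: Defs.derive => // q'; apply: IH.
Qed.

Definition default_value p : bool := if p is FQ Ex _ _ then false else true.

(** Each default value has to be justified in the state left by the clocks that expired earlier in
    the same round. That those are answered matters in a one-node network, where the clocks of a
    query and of its subquery expire together. *)
Lemma sound_foldl_expire s ps : inv s -> saturated s -> sound v s ->
  (forall ps1 p ps2 s', ps = ps1 ++ p :: ps2 -> inv s' -> saturated s' ->
    sound v s' -> state_le s s' ->
    (forall p1, p1 \in ps1 -> quantified p1 -> answered s' p1) ->
    quantified p -> answered s' p \/ default_value p = truth p) ->
  sound v (foldl (@fo_expire U l) s ps).
Proof.
move=> Hinv Hsat Hs; elim/last_ind: ps => // ps p IH H.
have {}IH : sound v (foldl (@fo_expire U l) s ps).
  apply: IH => ps1 p1 ps2 s' eqps; apply: (H _ _ (rcons ps2 p)).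
  by rewrite eqps rcons_cat.
rewrite foldl_rcons; set s' := foldl _ _ _ in IH *.
have I' : inv s' by apply: inv_foldl_expire.
have {H} Hp : quantified p -> answered s' p \/ default_value p = truth p.
  apply: (H ps p [::]) => //; first by rewrite cats1.
  - exact: foldl_expire_saturated.
  - exact: foldl_expire_le.
  - by move=> p1; apply: foldl_expire_answered.
case: p Hp => // -[] x p /(_ isT) Hp; (apply: sound_saturate; [exact: inv_learn|]);
  exact: sound_learn.
Qed.

Lemma sound_foldl_receive s ms :
  (forall p b, has (fun m => if m is MAnswer p' b' then (p' == p) && (b' == b)
                             else false) ms -> b = truth p) ->
  sound v s -> sound v (foldl (fo_receive (info v) (tbl v)) s ms).
Proof.
elim: ms s => //= m ms IH s H Hs; apply: IH.
  by move=> p b Hp; apply: H; rewrite Hp orbT.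
case: m H => //= [q _|p b H]; first exact: sound_pose.
by apply: sound_learn => //; right; apply: H; rewrite !eqxx.
Qed.

End NodeSound.

Lemma sound_start v : v \in V -> sound v (fo_run 0 v).
Proof.
move=> vV; rewrite [fo_run 0 v]fo_startE.
apply: (sound_saturate (Q0 := known_before 0 v) (A0 := answered_before 0 v)
  (C := fun p c => c = 2 * Delta * nb_symbols p)) => //; last exact: sound_pose.
apply: inv_pose => //.
- by move=> q q'; apply: good_derive.
- exact: query_weight_depth.
- exact: good_start.
Qed.

Lemma sound_mid t v : v \in V -> {in V, forall u, sound u (fo_run t u)} ->
  sound v (fo_mid t v).
Proof.
move=> vV Hs; rewrite /fo_mid /after_inbox.
have Hs' : sound v (foldl (fo_receive (info v) (tbl v)) (tick (fo_run t v)) (fo_inbox t v)).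
  apply: sound_foldl_receive; last by have := Hs v vV.
  move=> p b; rewrite has_fo_inbox; last by case.
  case/hasP=> u uV /andP[_ Hp]; have [H _] := Hs u uV; apply: H.
  have [iout _ _ _ _ _ _ _] := fo_run_inv t uV.
  elim: (fo_out _) iout Hp => //= m ms IH /andP[Hm /IH Hms] /orP[|//].
  by case: m Hm => // p' b' Hm /andP[/eqP <- /eqP <-].
apply: (sound_saturate (Q0 := known_before t.+1 v) (A0 := answered_before t.+1 v)
  (C := clock_inv_in t v)) Hs' => //.
exact: fo_received_inv.
Qed.

(* The [Delta] rounds left over are those that the answer needs to reach all the
   nodes that wait for it. *)
Lemma witness_answered t v Q x p : 0 < Delta -> v \in V ->
  known (fo_run t v) (QBool (FQ Q x p)) ->
  truth (FQ Q x p) = ~~ default_value (FQ Q x p) ->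
  (forall t' u, u \in V -> t' + Delta <= t + 2 * Delta * nb_symbols (FQ Q x p) ->
    sound u (fo_run t' u)) ->
  exists2 u, u \in V & exists2 t',
    t' + Delta = t + 2 * Delta * nb_symbols (FQ Q x p) & answered (fo_run t' u) (FQ Q x p).
Proof.
move=> D0 vV K Hnd Hs; set r := FQ Q x p in K Hnd Hs *.
(* A truth value other than the default means a witness for [Ex] and a counterevidence for [All];
   [b] is the node that provides it. *)
have [b bV Hb] : exists2 b, b \in V &
    sat V E J (upd (fun _ => x0) x b) p = ~~ default_value r.
  move: Hnd; rewrite /truth /r; case: Q {r K Hs} => /= [/hasP[b bV Hb]|/negbT].
    by exists b.
  by rewrite -has_predC => /hasP[b bV /negbTE Hb]; exists b.
set p' := simplify b (subst x b p).
have np' : nb_symbols p' < nb_symbols r.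
  by rewrite /r /= ltnS -(nb_symbols_subst x b p); apply: nb_symbols_simplify.
have Kb : known (fo_run (t + Delta) b) (QBool r).
  by apply: known_walk K => //; apply: walk_diam.
have He : (QBool p', Some (QBool r)) \in fo_queries (fo_run (t + Delta) b).
  exact: subquery_posed.
have [t' t't] : exists t', t' + Delta = t + 2 * Delta * nb_symbols r.
  exists (t + 2 * Delta * nb_symbols r - Delta); apply: subnK.
  apply: leq_trans (leq_addl t _); rewrite -mulnA mul2n -addnn.
  by apply: leq_trans (leq_addr _ _); rewrite leq_pmulr.
have le1 : t + Delta + 2 * Delta * nb_symbols p' <= t'.
  by rewrite -(leq_add2r Delta) t't; apply: clock_step.
have le2 : t + Delta <= t' by apply: leq_trans le1; apply: leq_addr.
(* A quantified instance is answered at the latest when its own clock expires, the other ones by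
   repeated simplification. *)
have At : answered (fo_run t' b) p'.
  case Hq: (quantified p').
    apply: (subquery_answered bV Hq He le1); apply: leq_trans le1.
    by rewrite -addn1 leq_add2l !muln_gt0 D0 quantified_nb.
  have := quantifier_free_answered bV (entry_known He) (negbT Hq).
  by apply: answered_le; apply: fo_run_le.
exists b => //; exists t' => //; have [c Hc] := answeredP At.
have Hc' : c = ~~ default_value r.
  rewrite (sound_answer (Hs t' b bV _) Hc) ?t't // -Hb; exact: truth_instance.
have [sub _ _] : state_le (fo_run (t + Delta) b) (fo_run t' b).
  exact: fo_run_le.
apply: (saturated_answered (@fo_run_saturated _ _) (sub _ He) Hc).
by rewrite Hc' /r; case: (Q).
Qed.

(** Strong induction on the round. If a default of round [t.+1] were wrong, evidence would have
    settled the query at some node in a round [t'] with [t' + Delta = t.+1]. Since [Delta] is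
    positive, soundness is known up to [t'], and the answer reaches [v] before the clock expires. *)
Lemma sound_fo_run t v : 0 < Delta -> v \in V -> sound v (fo_run t v).
Proof.
move=> D0; have [n] := ubnP t; elim: n t v => // n IH [|t] v lt vV; first exact: sound_start.
have Smid : sound v (fo_mid t v) by apply: sound_mid => // u uV; apply: IH.
suff [] : sound v (foldl (@fo_expire U l) (fo_mid t v) (due (fo_mid t v))) by split.
apply: (sound_foldl_expire (Q0 := known_before t.+1 v) (A0 := answered_before t.+1 v)
  (C := clock_inv_in t v)) => //; first exact: fo_mid_inv.
  exact: saturate_saturated.
move=> ps1 p ps2 s' eqps _ _ _ le _ Hq.
have: p \in due (fo_mid t v) by rewrite eqps mem_cat inE eqxx orbT.
case/mapP => -[p' c]; rewrite mem_filter => /andP[/= /eqP -> {c} Hc] pp.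
rewrite -{p'}pp in Hc.
have [_ _ [_ /(_ D0)[t0 [eqt Ht0]]]] := inv_clock (fo_mid_inv t vV) Hc.
(* A clock set in this very round cannot be due, since its initial value is positive. *)
case: Ht0 => [t0t|[t0t K0]].
  by have := quantified_nb Hq; move: eqt D0; rewrite t0t; case: (nb_symbols p) => //; nia.
case: (eqVneq (default_value p) (truth p)) => [->|Hd]; [by right|left].
apply: answered_le le _.
case: p Hq K0 Hd eqt {Hc eqps} => // Q x p _ K0 Hd eqt.
have Hnd : truth (FQ Q x p) = ~~ default_value (FQ Q x p).
  by move: Hd; case: (truth _); case: (default_value _).
have [u uV [t' eqt' A]] := witness_answered D0 vV K0 Hnd
  (fun t' u uV H => IH t' u ltac:(lia) uV).
have W := walk_diam uV vV.
(* The last of the [d.+1] hops ends in the middle of round [t.+1], so only [d] full rounds separate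
   [t'] from [t]. *)
case HD: Delta W D0 eqt eqt' => [//|d] W _ eqt eqt'.
have -> : t = t' + d by lia.
exact: answered_mid_walk W A.
Qed.

(** The clock list has the most recent first and a subquery sets its clock after its parent, so this
    is the order in which clocks of equal value expire. *)
Definition children_first v (ps : seq formula) : Prop :=
  forall ps1 p ps2 p', ps = ps1 ++ p :: ps2 -> derive v (QBool p) = Some (QBool p') ->
    quantified p' -> p' \in ps1.

(** Weights drop along a chain of derivations. If all known queries are heavier than [q], the chain
    never meets a known query, so every quantified subquery in it sets a clock of its own. *)
Lemma pose_clocks v k q par s : query_weight q <= k ->
  (forall q', known s q' -> query_weight q < query_weight q') ->
  (forall p, p \in unzip1 (fo_clocks s) -> known s (QBool p)) ->
  exists ps,
    [/\ unzip1 (fo_clocks (fo_pose (info v) (tbl v) k q par s)) = ps ++ unzip1 (fo_clocks s),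
        children_first v ps &
        forall p, q = QBool p -> quantified p -> par -> p \in ps].
Proof.
elim: k q par s => [|k IH] q par s Hk Hw Hc; rewrite fo_poseE.
all: have Kq : known s q = false by apply/negP => /Hw; rewrite ltnn.
all: rewrite Kq /=; set s1 := pose1 _ _ _ _.
all: have [ps [eps Hps1 Hps2]] : exists ps, [/\ unzip1 (fo_clocks s1) = ps ++ unzip1 (fo_clocks s),
   forall p, p \in ps -> ps = [:: p] /\ q = QBool p &
   forall p, q = QBool p -> quantified p -> par -> p \in ps].
1,3: rewrite /s1 pose1_clocks; case: q Kq {Hk Hw s1} => [xs cs p|p] Kq; first (by exists [::]);
   case: p Kq => [b|s2 t|ts|s2 t|p|p1 p2|p1 p2|Q x p] Kq; try (by exists [::]; split=> // ? [<-]);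
   case: par => [q0|]; last (by exists [::]);
   (case: ifP => [/Hc|_]; first by rewrite Kq);
   exists [:: FQ Q x p]; split=> // p'; [by rewrite inE => /eqP ->|by case=> <-; rewrite inE].
all: have leaf : (forall q', derive v q <> Some q') -> exists ps0,
   [/\ unzip1 (fo_clocks s1) = ps0 ++ unzip1 (fo_clocks s), children_first v ps0 &
       forall p, q = QBool p -> quantified p -> par -> p \in ps0].
1,3: move=> Hd; exists ps; split=> // ps1 p ps2 p' eps'; have := Hps1 p;
   by rewrite eps' mem_cat inE eqxx orbT => /(_ isT)[_ <-] /Hd.
- have leaf' := leaf (fun q' Hd => ltac:(by have := derive_weight Hd; lia)).
  by case: ifP.
- case Ht: (is_truth_value q).
    apply: leaf => q'; by case: (q) Ht => // -[] //= b _; rewrite eqxx.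
  case Hd: (derive v q) => [q'|]; last by apply: leaf => q'; rewrite Hd.
  have lt := derive_weight Hd.
  case: (IH q' (Some q) s1) => [||p|ps' [eps' C' H']].
  + lia.
  + by move=> q1; rewrite pose1_known => /orP[/eqP ->|/Hw]; lia.
  + rewrite eps mem_cat pose1_known => /orP[/Hps1[_ <-]|/Hc ->]; by rewrite ?eqxx ?orbT.
  (* [ps] holds at most the clock of [q] itself; the clocks of its subqueries are set later and
     stand in front. *)
  exists (ps' ++ ps); split.
  + by rewrite eps' eps catA.
  + move=> ps1 p ps2 p'; case: ps Hps1 {eps Hps2 leaf} => [|p0 ps] Hps1.
      by rewrite cats0; apply: C'.
    have [-> qp0] : p0 :: ps = [:: p0] /\ q = QBool p0 by apply: Hps1; rewrite inE eqxx.
    elim/last_ind: ps2 => [|ps2 z _].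
      rewrite !cats1 => /rcons_inj[<- <-]; rewrite -qp0 Hd => -[q'p'] Hq.
      exact: H' q'p' Hq isT.
    by rewrite cats1 -rcons_cons -rcons_cat => /rcons_inj[/C' H _]; apply: H.
  + by move=> p qp Hq Hpar; rewrite mem_cat (Hps2 p) ?orbT.
Qed.

Lemma eq_nodes : Delta = 0 -> {in V &, forall u v, u = v}.
Proof. by move=> D0 u v uV vV; have := walk_diam uV vV; rewrite D0 => /eqP. Qed.

(* All clocks expire in the first round, those of the innermost quantifiers
   first. *)
Lemma sound_single v : Delta = 0 -> v \in V -> sound v (fo_run 1 v).
Proof.
move=> D0 vV.
have Vv u : u \in V -> u = v by move=> uV; apply: eq_nodes.
have Smid : sound v (fo_mid 0 v) by apply: sound_mid => // u uV; apply: sound_start.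
have inv0 := fo_run_inv 0 vV.
have clk : unzip1 (fo_clocks (fo_mid 0 v)) = unzip1 (fo_clocks (fo_run 0 v)).
  rewrite /fo_mid /after_inbox saturate_clocks.
  (* [E] may have a loop at the only node, which then hears its own broadcasts; these queries are
     known to it, so they set no further clock. *)
  have : forall q, sent_query q (fo_inbox 0 v) -> known (tick (fo_run 0 v)) q.
    move=> q; rewrite sent_query_inbox => /hasP[u /Vv -> /andP[_ Hq]].
    exact: justified_query (inv_out inv0) Hq.
  have -> : unzip1 (fo_clocks (fo_run 0 v)) = unzip1 (fo_clocks (tick (fo_run 0 v))).
    by rewrite /unzip1 /= -map_comp.
  elim: (fo_inbox 0 v) (tick _) => //= m ms IH s Hs; rewrite IH.
  - case: m Hs => //= [q Hs|p b _]; last by rewrite learn_clocks.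
    have Kq : known s q by apply: Hs; rewrite eqxx.
    rewrite fo_poseE Kq /= pose1_clocks; by case: (q) => // -[].
  - move=> q Hq; apply: known_le (receive_le _ _ _ _) _; apply: Hs.
    by rewrite Hq orbT.
(* With diameter 0 every clock has value 0, so all of them are due. *)
have due_clk : due (fo_mid 0 v) = unzip1 (fo_clocks (fo_run 0 v)).
  rewrite -clk /due (_ : filter _ _ = fo_clocks (fo_mid 0 v)) //.
  apply/all_filterP/allP => -[p c] /(inv_clock (fo_mid_inv 0 vV))[_ _ []].
  by rewrite D0 muln0 mul0n leqn0.
have ord : children_first v (due (fo_mid 0 v)).
  rewrite due_clk [fo_run 0 v]fo_startE saturate_clocks.
  have [||//|ps [-> H _]] := @pose_clocks v (query_depth (start_query v)) (start_query v)
    None (fo_init U l).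
  - exact: query_weight_depth.
  - by [].
  - by rewrite cats0.
suff [] : sound v (foldl (@fo_expire U l) (fo_mid 0 v) (due (fo_mid 0 v))) by split.
apply: (sound_foldl_expire (Q0 := known_before 1 v) (A0 := answered_before 1 v)
  (C := clock_inv_in 0 v)) => //; first exact: fo_mid_inv.
  exact: saturate_saturated.
move=> ps1 p ps2 s' eqps Iv' Sat' Snd' le Aps Hq.
have: p \in due (fo_mid 0 v) by rewrite eqps mem_cat inE eqxx orbT.
rewrite due_clk => /mapP[[p' c] Hc /= pp]; rewrite -{p'}pp in Hc.
have [_ K0 _] := inv_clock inv0 Hc.
case: (eqVneq (default_value p) (truth p)) => [->|Hd]; [by right|left].
case: p Hq K0 Hd eqps {Hc} => // Q x p _ K0 Hd eqps.
set p1 := simplify v (subst x v p).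
have Hdp : derive v (QBool (FQ Q x p)) = Some (QBool p1) by [].
have He := subquery_posed vV K0 isT Hdp.
have {He} He : (QBool p1, Some (QBool (FQ Q x p))) \in fo_queries s'.
  have [sub _ _] := state_le_trans (after_inbox_le (info v) (tbl v) (fo_inbox 0 v) (fo_run 0 v)) le.
  exact: sub.
have A1 : answered s' p1.
  case Hq1: (quantified p1); first by apply: Aps => //; apply: ord eqps Hdp Hq1.
  have K1 : known (fo_run 0 v) (QBool p1).
    exact: entry_known (subquery_posed vV K0 isT Hdp).
  have := quantifier_free_answered vV K1 (negbT Hq1); rewrite D0 muln0 mul0n addn0.
  by apply: answered_le; apply: state_le_trans (after_inbox_le _ _ _ _) le.
have [c' Hc'] := answeredP A1.
apply: (saturated_answered Sat' He Hc').
(* Over a single node a quantified formula has the truth value of its only instance; as this is not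
   the default value, the answer to the instance settles the formula. *)
have: c' = truth (FQ Q x p).
  rewrite (sound_answer Snd' Hc') truth_instance // /truth /=.
  case: (Q); rewrite /upd.
    apply/idP/hasP => [H|[u /Vv -> //]]; by exists v.
  by apply/idP/allP => [H u /Vv ->|H] //; apply: H.
by move: Hd => /[swap] ->; rewrite /default_value; case: (truth _); case: (Q).
Qed.

(** The maximum accounts for the one-node network, where tau is 0 and expires one round after it is
    set. *)
Definition eval_rounds : nat := maxn 1 (2 * Delta * fp_nb_symbols F).

Lemma buffer_sound v cs : v \in V -> cs \in fo_buffer (fo_run eval_rounds v) ->
  exists a : l.+1.-tuple U, [/\ cs = a, thead a = v & fp_op V E F J a].
Proof.
move=> vV; suff [_ H] : sound v (fo_run eval_rounds v) by apply: H.
case: (posnP Delta) => D0; last exact: sound_fo_run.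
by rewrite /eval_rounds D0 muln0 mul0n; apply: sound_single.
Qed.

Lemma tuple_rcons_last (T : Type) n (a : n.+1.-tuple T) :
  belast (thead a) (behead a) = take n a /\ drop n a = [:: last (thead a) (behead a)].
Proof.
have : tval a = thead a :: behead a by rewrite {1}(tuple_eta a).
have : size (behead a) = n by rewrite size_behead size_tuple.
move: (thead a) (behead a) => x s sz ->.
by split; rewrite lastI -cats1 ?take_size_cat ?drop_size_cat ?size_belast.
Qed.

(** The components are instantiated from the right, starting at the node named by the last one; the
    open query needs at most [Delta] rounds to travel from the node of one component to that of the
    preceding one. *)
Lemma open_query_known (a : l.+1.-tuple U) j : {subset a <= V} -> j <= l ->
  exists p, known (fo_run ((l - j) * Delta) (nth (thead a) a j))
              (QOpen (take j (fp_vars F)) (drop j a) p).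
Proof.
move=> aV; have nV k : k <= l -> nth (thead a) a k \in V.
  by move=> kl; apply/aV/mem_nth; rewrite size_tuple.
move=> jl; have -> : j = l - (l - j) by lia.
elim: (l - j) (leq_subr j l) => [|d IH] dl.
  rewrite subn0 subnn mul0n.
  have [_ dr] := tuple_rcons_last a; have [bl _] := tuple_rcons_last (fp_vars F).
  have nl : nth (thead a) a l = last (thead a) (behead a).
    by rewrite -[l in nth _ _ l]addn0 -nth_drop dr.
  exists (simplify (nth (thead a) a l)
    (subst (last (thead (fp_vars F)) (behead (fp_vars F))) (nth (thead a) a l) body)).
  rewrite [fo_run _ _]fo_startE; apply: known_le (saturate_le _) _.
  apply: (@entry_known _ _ None); rewrite dr -nl -bl; exact: fo_pose_entry.
have {IH} [p Hp] := IH (ltnW dl).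
have ld : l - (l - d.+1) = d.+1 by lia.
have ld' : l - (l - d) = d by lia.
rewrite ld; rewrite ld' in Hp.
set j' := l - d.+1; have j'S : l - d = j'.+1 by rewrite /j'; lia.
rewrite j'S in Hp; have j'l : j' < l by rewrite /j'; lia.
have Kj : known (fo_run (d.+1 * Delta) (nth (thead a) a j'))
    (QOpen (take j'.+1 (fp_vars F)) (drop j'.+1 a) p).
  rewrite mulSn addnC; apply: known_walk Hp => //; first exact: nV.
  by apply: walk_diam; apply: nV => //; apply: ltnW.
have tk : take j'.+1 (fp_vars F) = rcons (take j' (fp_vars F)) (nth 0 (fp_vars F) j').
  by rewrite (take_nth 0) // size_tuple; apply: ltnW.
have [x [xs [xxs bl]]] : exists x xs, x :: xs = take j'.+1 (fp_vars F) /\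
    belast x xs = take j' (fp_vars F).
  rewrite tk; case: (take j' _) => [|y ys] /=.
    by exists (nth 0 (fp_vars F) j'), [::].
  by exists y, (rcons ys (nth 0 (fp_vars F) j')); rewrite belast_rcons.
rewrite -xxs in Kj.
have := subquery_posed (nV j' (ltnW j'l)) Kj isT erefl => /entry_known H.
rewrite (drop_nth (thead a)) ?size_tuple; last exact: ltnW.
by eexists; rewrite -bl; apply: H.
Qed.

Lemma buffer_complete (a : l.+1.-tuple U) : fp_op V E F J a ->
  tval a \in fo_buffer (fo_run eval_rounds (thead a)).
Proof.
move=> Ha; have aV : {subset a <= V} by move: Ha => /andP[/allP].
have hV : thead a \in V by apply/aV/mem_tnth.
have [p] := open_query_known aV (leq0n l).
rewrite take0 drop0 subn0 nth0 -[head _ _]/(head _ (tval a)).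
have -> : head (thead a) a = thead a by case/tupleP: (a) => y ys.
move=> K; have Gq := inv_good (fo_run_inv _ hV) K.
have Hd : derive (thead a) (QOpen [::] a p) = Some (QBool p).
  by rewrite /= ohead_tuple eqxx.
have He := subquery_posed hV K isT Hd.
have [_ _ _ np] : good_formula [::] p by case: Gq.
(* The instantiation is covered by the share [2 * Delta * l.+1] of the listed variables, the Boolean
   query by that of the body. *)
have le : l * Delta + 2 * Delta * nb_symbols p <= eval_rounds.
  apply: leq_trans (leq_maxr _ _); rewrite /fp_nb_symbols mulnDr.
  apply: leq_add; last by rewrite leq_mul2l np orbT.
  rewrite mulnC -mulnA mul2n -addnn; apply: leq_trans (leq_addr _ _).
  by rewrite leq_mul2l leqnSn orbT.
have A : answered (fo_run eval_rounds (thead a)) p.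
  case Hq: (quantified p).
    apply: (subquery_answered hV Hq He le).
    case: (posnP Delta) => D0; first by rewrite D0 muln0 leq_maxl.
    apply: leq_trans le; rewrite -addn1 leq_add2l !muln_gt0 D0; exact: quantified_nb.
  have := quantifier_free_answered hV (entry_known He) (negbT Hq).
  by apply: answered_le; apply: fo_run_le.
have S : sound (thead a) (fo_run eval_rounds (thead a)).
  case: (posnP Delta) => D0; last exact: sound_fo_run.
  by rewrite /eval_rounds D0 muln0 mul0n; apply: sound_single.
have [c Hc] := answeredP A.
have [sub _ _] : state_le (fo_run (l * Delta) (thead a)) (fo_run eval_rounds (thead a)).
  by apply: fo_run_le; apply: leq_trans le; apply: leq_addr.
apply: (saturated_stored (@fo_run_saturated _ _) (sub _ He)).
by rewrite Hc (sound_answer S Hc) (truth_open Gq) Ha.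
Qed.

Lemma fo_out_no_inform t v : v \in V -> ~~ has (@is_inform U l) (fo_out (fo_run t v)).
Proof.
move=> vV; rewrite -all_predC; apply: sub_all (inv_out (fo_run_inv t vV)).
by case.
Qed.

End Tables.
End FirstOrder.

(** * Walks and distances *)

Section Walks.

Variables (U : eqType) (V : seq U) (E : rel U).
Hypothesis E_V : forall u v, E u v -> (u \in V) && (v \in V).
Implicit Types (u v z : U) (k : nat).

(** [walk] recurses on the first step, whereas a flood grows at its far end. *)
Lemma walkSr k u v :
  walk V E k.+1 u v = walk V E k u v || has (fun z => walk V E k u z && E z v) V.
Proof.
apply/idP/orP => [|[W|/hasP[z _ /andP[W Ezv]]]].
- elim: k u => [|k IH] u /=.
    case/orP => [->|/hasP[z zV /andP[Euz /eqP <-]]]; [by left|right].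
    by apply/hasP; exists u; rewrite ?eqxx //; case/andP: (E_V Euz).
  case/orP => [->|/hasP[z zV /andP[Euz /IH[W|/hasP[y yV /andP[W Eyv]]]]]]; first by left.
    by left; apply/orP; right; apply/hasP; exists z; rewrite ?Euz.
  right; apply/hasP; exists y => //; rewrite Eyv andbT; apply/orP; right.
  by apply/hasP; exists z; rewrite ?Euz.
- elim: k u W => [|k IH] u /= => [->//|].
  case/orP => [->//|/hasP[z zV /andP[Euz /IH W]]].
  by apply/orP; right; apply/hasP; exists z; rewrite // Euz.
- elim: k u W => [|k IH] u /=.
    move=> /eqP ->; apply/orP; right; apply/hasP; exists v; rewrite ?Ezv ?eqxx //.
    by case/andP: (E_V Ezv).
  case/orP => [/eqP ->|/hasP[y yV /andP[Euy /IH W]]]; apply/orP; right; apply/hasP.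
    exists v; rewrite ?Ezv //=; last by rewrite eqxx.
    by case/andP: (E_V Ezv).
  by exists y; rewrite // Euy.
Qed.

Lemma walk_le k k' u v : k <= k' -> walk V E k u v -> walk V E k' u v.
Proof.
move=> /subnK <-; elim: (k' - k) => // d IH /IH W.
by rewrite addSn walkSr W.
Qed.

Lemma path_walk u p : path E u p -> walk V E (size p) u (last u p).
Proof.
elim: p u => //= z p IH u /andP[Euz /IH W]; apply/orP; right.
by apply/hasP; exists z; rewrite ?Euz //; case/andP: (E_V Euz).
Qed.

Lemma connected_walk_diam :
  {in V &, forall u v, exists2 p, path E u p & last u p = v} ->
  {in V &, forall u v, walk V E (diam V E) u v}.
Proof.
move=> conn u v uV vV.
have Hd : walk V E (dist V E u v) u v.
  (* A path without repetition has fewer than [size V] edges, so the search in [dist] succeeds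
     within its range. *)
  have [p Hp lp] := conn u v uV vV; case/shortenP: Hp lp => q Hq uq _ lq.
  have sq : size q < size V.
    apply: (@uniq_leq_size _ (u :: q)) => // z; rewrite inE => /orP[/eqP -> //|].
    elim: q u Hq {uV uq lq} => //= y q IH u /andP[Euy /IH H]; rewrite inE.
    by case/orP => [/eqP ->|/H //]; case/andP: (E_V Euy).
  have hq : has (fun k => walk V E k u v) (iota 0 (size V)).
    by apply/hasP; exists (size q); rewrite ?mem_iota // -lq path_walk.
  have := nth_find 0 hq; rewrite nth_iota //.
  by move: hq; rewrite has_find size_iota.
apply: walk_le Hd; rewrite /diam.
apply: leq_trans (@leq_bigmax_seq _ V xpredT (fun u => \max_(v <- V) dist V E u v) u uV isT).
exact: (@leq_bigmax_seq _ V xpredT (fun v => dist V E u v) v vV isT).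
Qed.

End Walks.

(** * Stages of a fixpoint *)

Section Stages.

Variables (U : eqType) (l : nat) (V : seq U) (E : rel U) (F : fpformula U l).

Lemma eq_sat (J J' : pred (l.+1.-tuple U)) e p : J =1 J' ->
  sat V E J e p = sat V E J' e p.
Proof.
move=> JJ; elim: p e => //= [p IH|p IHp q IHq|p IHp q IHq|Q x p IH] e.
- by rewrite IH.
- by rewrite IHp IHq.
- by rewrite IHp IHq.
- by case: Q; [apply: eq_has|apply: eq_all] => a; rewrite IH.
Qed.

Lemma fp_stage_fix i k : fp_stage V E F i.+1 =1 fp_stage V E F i ->
  fp_stage V E F (i + k) =1 fp_stage V E F i.
Proof.
move=> Hi; elim: k => [|k IH] a; first by rewrite addn0.
by rewrite addnS -Hi /= /fp_op (eq_sat _ _ IH) IH.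
Qed.

Lemma fp_stage_unique i j : fp_stage V E F i.+1 =1 fp_stage V E F i ->
  fp_stage V E F j.+1 =1 fp_stage V E F j -> fp_stage V E F i =1 fp_stage V E F j.
Proof.
move=> Hi Hj a; case: (leqP i j) => [|/ltnW] /subnKC <-; first by rewrite fp_stage_fix.
by rewrite fp_stage_fix.
Qed.

Lemma fp_stage_nodes i a : fp_stage V E F i a -> all (mem V) a.
Proof. by elim: i => //= i IH /orP[/andP[]|/IH]. Qed.

Fixpoint tuples_over (n : nat) : seq (n.-tuple U) :=
  if n is n'.+1 then [seq cons_tuple x t | x <- V, t <- tuples_over n']
  else [:: [tuple]].

Lemma mem_tuples_over n (a : n.-tuple U) : all (mem V) a -> a \in tuples_over n.
Proof.
elim: n a => [|n IH] a; first by rewrite tuple0.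
case/tupleP: a => x a /= /andP[xV /IH aV].
by apply/allpairsP; exists (x, a).
Qed.

(** Stages grow inside a finite list of tuples: as long as none repeats, stage [n] has at least [n]
    entries there, which is impossible beyond the length of the list. *)
Lemma fp_stage_stops : exists i, fp_stage V E F i.+1 =1 fp_stage V E F i.
Proof.
set L := tuples_over l.+1; set st := fp_stage V E F.
have H n : (exists i, st i.+1 =1 st i) \/ n <= count (st n) L.
  elim: n => [|n [?|IH]]; [by right|by left|].
  case HL: (all (fun a => st n.+1 a ==> st n a) L).
    left; exists n => a; apply/idP/idP => [Ha|]; last by rewrite /st /= => ->; rewrite orbT.
    move/allP/(_ a (mem_tuples_over (fp_stage_nodes Ha))): HL => /implyP; exact.
  right; move/negbT: HL; rewrite -has_predC => /hasP[a aL /=]; rewrite negb_imply.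
  case/andP=> H1 H2; apply: leq_ltn_trans IH _; apply: count_lt aL H2 H1.
  by move=> b; rewrite /st /= => ->; rewrite orbT.
by case: (H (size L).+1) => // /leq_trans/(_ (count_size _ _)); rewrite ltnn.
Qed.

End Stages.

(** * The fixpoint engine *)

Section FixpointEngine.

Variables (U : eqType) (l : nat) (V : seq U) (E : rel U).
Hypothesis V_neq0 : V != [::].
Hypothesis E_V : forall u v, E u v -> (u \in V) && (v \in V).
Hypothesis E_sym : symmetric E.
Let Delta := diam V E.
Hypothesis walk_diam : {in V &, forall u v, walk V E Delta u v}.

Variables (F : fpformula U l) (r : U).
Hypothesis F_consts : {subset consts (fp_body F) <= V}.
Hypothesis rV : r \in V.

Notation info := (info_of V E).
Notation run := (run V E F r).
Notation walk := (walk V E).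
Notation message := (message U l).

Definition run_inbox t v : seq message := flatten [seq (run t u).2 | u <- V & E u v].

Lemma runS t v : run t.+1 v = node_step (info v) (run t v).1 (run_inbox t v).
Proof. by []. Qed.

Lemma has_run_inbox (P : pred message) t v :
  has P (run_inbox t v) = has (fun u => E u v && has P (run t u).2) V.
Proof.
rewrite /run_inbox; move: (run t) => f; elim: V => //= u W IH.
by case: ifP => /= Euv; rewrite ?has_cat IH.
Qed.

(** Serves both floods, of the request and of the informing messages: [f k v] says that [v] is
    reached within [k] rounds, and a node broadcasts only when first reached. *)
Definition newly (f : nat -> U -> bool) k v : bool := f k v && ((k == 0) || ~~ f k.-1 v).

(** Forwarding only once loses nothing: the neighbours of a node reached earlier are already
    reached. *)
Lemma newly_step (f : nat -> U -> bool) k v :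
  (forall j u, f j.+1 u = f j u || has (fun z => f j z && E z u) V) ->
  f k.+1 v = f k v || has (fun u => E u v && newly f k u) V.
Proof.
move=> Hf; rewrite Hf; case fkv: (f k v) => //=; apply: eq_in_has => u uV.
rewrite andbC /newly; case Euv: (E u v) => //=.
case: k fkv => [|k] fkv; first by rewrite andbT.
case fk: (f k u); last by rewrite /= andbT.
rewrite andbF; suff: f k.+1 v by rewrite fkv.
by rewrite Hf; apply/orP; right; apply/hasP; exists u; rewrite ?fk.
Qed.

(** All senders of a round carry the same counter, so it does not matter which message comes first
    in the inbox. *)
Lemma first_fix_inbox t v c (P : pred U) :
  {in V, forall u, (run t u).2 = if P u then [:: MFix F c] else [::]} ->
  first_fix (run_inbox t v) = if has (fun u => E u v && P u) V then Some (F, c) else None.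
Proof.
rewrite /run_inbox; move: (run t) => f; elim: V => //= u W IH H; case: ifP => /= Euv; last first.
  by apply: IH => z zW; apply: H; rewrite inE zW orbT.
rewrite H ?inE ?eqxx //; case: (P u) => //=.
by apply: IH => z zW; apply: H; rewrite inE zW orbT.
Qed.

(** A node first reached in round [k] receives the counter [Delta - k], so all clocks sigma run out
    in the same round. *)
Lemma run_flooding k v : v \in V -> k < Delta ->
  run k v = if walk k r v then
    (Flooding F (Delta - k), if newly (fun k => walk k r) k v
                             then [:: MFix F (Delta - k).-1] else [::])
    else (Idle U l, [::]).
Proof.
elim: k v => [|k IH] v vV kD.
  rewrite /= (eq_sym r v) /newly /= andbT -/Delta subn0 (eq_sym r v).
  by case: (v == r) => //=; case: (Delta) kD.
have Hfix : first_fix (run_inbox k v) =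
    if has (fun u => E u v && newly (fun k => walk k r) k u) V
    then Some (F, (Delta - k).-1) else None.
  apply: first_fix_inbox => u uV; rewrite IH //; last exact: ltnW.
  by rewrite /newly /=; case: (walk k r u).
have Hw := @newly_step (fun k => walk k r) k v (fun j u => walkSr E_V j r u).
rewrite runS IH //; last exact: ltnW.
rewrite /= in Hw; rewrite {2}/newly [_ == 0]/= orFb [_.+1.-1]/=.
rewrite [walk k.+1 r v]Hw; case: (walk k r v) => /=.
  have -> : (Delta - k).-1 == 0 = false by lia.
  by rewrite subnS.
rewrite Hfix; case: has => //.
have [d Hd] : exists d, Delta - k.+1 = d.+1 by exists (Delta - k.+2); lia.
by rewrite -subnS Hd.
Qed.

Lemma run_first_stage v : v \in V -> run Delta v = start_stage (info v) F [::].
Proof.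
move=> vV; case HD: Delta => [|d].
  have := walk_diam rV vV; rewrite HD /= eq_sym => ->.
  by rewrite /= -/Delta HD.
have Hfix : first_fix (run_inbox d v) =
    if has (fun u => E u v && newly (fun k => walk k r) d u) V
    then Some (F, (Delta - d).-1) else None.
  apply: first_fix_inbox => u uV; rewrite run_flooding ?HD //.
  by rewrite /newly /=; case: (walk d r u).
have Hw := @newly_step (fun k => walk k r) d v (fun j u => walkSr E_V j r u).
(* Two kinds of nodes start here together: those whose sigma runs out, and those reached only now,
   with counter 0. *)
have := walk_diam rV vV; rewrite HD Hw runS run_flooding ?HD // subSnn.
case: (walk d r v) => //= H; by rewrite Hfix H HD subSnn.
Qed.

(** * One stage: evaluation followed by the informing flood *)

Section Stage.

Variables (S i : nat) (tbl : U -> table U) (extra : U -> seq message).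
Let J := fp_stage V E F i.
Hypothesis tbl_ok : {in V, forall v, table_of J v (tbl v)}.
Hypothesis extra_inform : forall v, all (@is_inform U l) (extra v).
Hypothesis run_S : {in V, forall v, run S v =
  let s := fo_start (info v) (tbl v) F in
  (Evaluating F (tbl v) (2 * Delta * fp_nb_symbols F) s, extra v ++ fo_out s)}.

Let T := 2 * Delta * fp_nb_symbols F.
Let L := eval_rounds V E F.
Notation fo := (fo_run V E F tbl extra).

Let L_def : L = maxn 1 T. Proof. by []. Qed.

Lemma run_evaluating k v : v \in V -> k < L ->
  run (S + k) v =
  (Evaluating F (tbl v) (T - k) (fo k v), (if k == 0 then extra v else [::]) ++ fo_out (fo k v)).
Proof.
elim: k v => [|k IH] v vV kL; first by rewrite addn0 subn0 run_S.
rewrite addnS runS IH //; last exact: ltnW.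
have -> : run_inbox (S + k) v = fo_inbox V E F tbl extra k v.
  congr flatten; apply/eq_in_map => u; rewrite mem_filter => /andP[_ uV].
  by rewrite IH //; apply: ltnW.
rewrite /=; have -> : (T - k).-1 == 0 = false by move: kL; rewrite L_def; lia.
by rewrite subnS.
Qed.

Definition new_tuples v : table U := [seq cs <- fo_buffer (fo L v) | cs \notin tbl v].

Lemma run_evaluated v : v \in V ->
  run (S + L) v =
  (Informing F (new_tuples v ++ tbl v) Delta (new_tuples v != [::]),
   fo_out (fo L v) ++ if new_tuples v != [::] then [:: MInform U l] else [::]).
Proof.
move=> vV; have [k Lk] : exists k, L = k.+1 by exists L.-1; rewrite L_def; lia.
rewrite /new_tuples Lk addnS runS run_evaluating ?Lk //.
have -> : run_inbox (S + k) v = fo_inbox V E F tbl extra k v.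
  congr flatten; apply/eq_in_map => u; rewrite mem_filter => /andP[_ uV].
  by rewrite run_evaluating ?Lk.
have Tk : (T - k).-1 == 0 by move: Lk; rewrite L_def; lia.
by rewrite [node_step _ _ _]/= Tk.
Qed.

(** The reach of the informing flood, with all producers of new tuples as simultaneous sources. *)
Definition flag k v : bool := has (fun u => (new_tuples u != [::]) && walk k u v) V.

Lemma flagS k v : flag k.+1 v = flag k v || has (fun z => flag k z && E z v) V.
Proof.
apply/hasP/orP => [[u uV /andP[Hu]]|[/hasP[u uV /andP[Hu W]]|]].
- rewrite walkSr // => /orP[W|/hasP[z zV /andP[W Ezv]]]; [left|right; apply/hasP].
    by apply/hasP; exists u; rewrite ?Hu.
  by exists z; rewrite // Ezv andbT; apply/hasP; exists u; rewrite ?Hu.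
- by exists u; rewrite // Hu walkSr // W.
- case/hasP=> z zV /andP[/hasP[u uV /andP[Hu W]] Ezv].
  exists u; rewrite // Hu walkSr //; apply/orP; right; apply/hasP.
  by exists z; rewrite // W.
Qed.

(** Like tau, the clock eta takes one round in a one-node network although it is 0. *)
Let M := maxn 1 Delta.

Lemma received_inform k v :
  {in V, forall u, has (@is_inform U l) (run (S + L + k) u).2 = newly flag k u} ->
  flag k v || has (@is_inform U l) (run_inbox (S + L + k) v) = flag k.+1 v.
Proof.
move=> H; rewrite has_run_inbox (newly_step k v flagS); congr (_ || _).
by apply: eq_in_has => u uV; rewrite H.
Qed.

Lemma run_informing k v : v \in V -> k < M ->
  (run (S + L + k) v).1 = Informing F (new_tuples v ++ tbl v) (Delta - k) (flag k v) /\
  has (@is_inform U l) (run (S + L + k) v).2 = newly flag k v.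
Proof.
elim: k v => [|k IH] v vV kM.
  have -> : flag 0 v = (new_tuples v != [::]).
    by apply/hasP/idP => [[u uV /andP[Hu /eqP <-]] //|H]; exists v; rewrite //= H eqxx.
  rewrite addn0 subn0 run_evaluated //; split=> //=; rewrite has_cat.
  (* The last messages of the evaluation leave together with the first informing messages and must
     not be mistaken for them. *)
  have /negbTE -> : ~~ has (@is_inform U l) (fo_out (fo L v)).
    exact: (fo_out_no_inform V_neq0 E_V E_sym F_consts tbl_ok extra_inform).
  rewrite /newly andbT.
  have -> : flag 0 v = (new_tuples v != [::]).
    by apply/hasP/idP => [[u uV /andP[Hu /eqP <-]] //|H]; exists v; rewrite //= H eqxx.
  by case: ifP.
have Hr := @received_inform k v (fun u uV => (IH u uV (ltnW kM)).2).
have [s1 _] := IH v vV (ltnW kM).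
rewrite addnS runS s1 [node_step _ _ _]/=.
have -> : (Delta - k).-1 == 0 = false by move: kM; rewrite /M; lia.
rewrite Hr; split; first by rewrite subnS.
rewrite /newly -Hr [(_, _).2]/=.
by case: (has _ (run_inbox _ _)); case: (flag k v).
Qed.

(** The right-hand side does not mention [v]: the flood has covered the network, so all nodes agree
    whether to go on. *)
Lemma flag_last v : v \in V -> flag M v = has (fun u => new_tuples u != [::]) V.
Proof.
move=> vV; apply: eq_in_has => u uV; rewrite (walk_le E_V _ (walk_diam uV vV)) ?andbT //.
exact: leq_maxr.
Qed.

(** Nodes first reached in the round in which eta expires still forward. These messages arrive in
    the first round of the next evaluation, which ignores them; they are the [extra] of the next
    stage. *)
Definition late_informs v : seq message :=
  if has (@is_inform U l) (run_inbox (S + L + M.-1) v) && ~~ flag M.-1 v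
  then [:: MInform U l] else [::].

Lemma run_stage_end v : v \in V ->
  run (S + L + M) v =
  if has (fun u => new_tuples u != [::]) V then
    let s := fo_start (info v) (new_tuples v ++ tbl v) F in
    (Evaluating F (new_tuples v ++ tbl v) (2 * Delta * fp_nb_symbols F) s,
     late_informs v ++ fo_out s)
  else (Halted l (new_tuples v ++ tbl v), late_informs v).
Proof.
move=> vV; have [k Mk] : exists k, M = k.+1 by exists M.-1; rewrite /M; lia.
have kM : k < M by rewrite Mk.
have Hr := @received_inform k v (fun u uV => (run_informing uV kM).2).
have [s1 _] := run_informing vV kM.
rewrite -(flag_last vV) /late_informs Mk addnS runS s1 [node_step _ _ _]/=.
have -> : (Delta - k).-1 == 0 by move: Mk; rewrite /M; lia.
by rewrite Hr; case: ifP.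
Qed.

Lemma new_tuplesP v cs : v \in V -> cs \in new_tuples v <->
  exists a : l.+1.-tuple U, [/\ cs = a, thead a = v, fp_op V E F J a & ~~ J a].
Proof.
move=> vV; rewrite mem_filter; split.
  case/andP=> Hn Hb.
  have [a [csa hv Ha]] := buffer_sound V_neq0 E_V E_sym walk_diam F_consts tbl_ok
    extra_inform r vV Hb.
  exists a; split=> //; apply: contra Hn => Ja; apply/(tbl_ok vV); by exists a.
case=> a [-> hv Ha Ja]; apply/andP; split.
  apply: contra Ja => /(tbl_ok vV)[a' [/val_inj -> //]].
rewrite -hv.
exact: (buffer_complete V_neq0 E_V E_sym walk_diam F_consts tbl_ok extra_inform r Ha).
Qed.

Lemma next_table v : v \in V ->
  table_of (fp_stage V E F i.+1) v (new_tuples v ++ tbl v).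
Proof.
move=> vV cs; rewrite mem_cat; split.
  case/orP => [/(new_tuplesP _ vV)[a [-> hv Ha _]]|/(tbl_ok vV)[a [-> hv Ja]]];
    by exists a; split=> //=; rewrite ?Ha // -/J Ja orbT.
case=> a [-> hv /=]; rewrite -/J; case Ja: (J a).
  by move=> _; apply/orP; right; apply/(tbl_ok vV); exists a.
by rewrite orbF => Ha; apply/orP; left; apply/(new_tuplesP _ vV); exists a; rewrite Ja.
Qed.

Lemma no_new_tuples : ~~ has (fun u => new_tuples u != [::]) V <->
  fp_stage V E F i.+1 =1 fp_stage V E F i.
Proof.
split=> [/hasPn H a|H].
  rewrite /= -/J; case Ja: (J a); rewrite ?orbT // orbF; apply/negP => Ha.
  have hV : thead a \in V by move: (Ha) => /andP[/allP/(_ _ (mem_tnth ord0 a))].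
  have : tval a \in new_tuples (thead a).
    by apply/(new_tuplesP _ hV); exists a; rewrite Ja.
  by have := H _ hV; rewrite negbK => /eqP ->.
apply/hasPn => u uV; rewrite negbK; apply/eqP; case Hn: (new_tuples u) => [//|cs css].
have /(new_tuplesP _ uV)[a [_ _ Ha Ja]] : cs \in new_tuples u by rewrite Hn inE eqxx.
by have := H a; rewrite /= Ha -/J (negbTE Ja).
Qed.

End Stage.

(** * The sequence of stages and its termination *)

Definition stage_begins S i : Prop := exists tbl extra,
  [/\ {in V, forall v, table_of (fp_stage V E F i) v (tbl v)},
      forall v, all (@is_inform U l) (extra v) &
      {in V, forall v, run S v =
        let s := fo_start (info v) (tbl v) F in
        (Evaluating F (tbl v) (2 * Delta * fp_nb_symbols F) s, extra v ++ fo_out s)}].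

Definition run_halts S i : Prop :=
  fp_stage V E F i.+1 =1 fp_stage V E F i /\
  {in V, forall v, exists2 tb, (run S v).1 = Halted l tb & table_of (fp_stage V E F i) v tb}.

Lemma eq_table_of (J J' : pred (l.+1.-tuple U)) v tb : J =1 J' ->
  table_of J v tb -> table_of J' v tb.
Proof.
move=> JJ H cs; split=> [/H[a [? ? Ja]]|[a [? ? Ja]]].
  by exists a; rewrite -JJ.
by apply/H; exists a; rewrite JJ.
Qed.

(** By induction on [i], either the engine starts a stage with the tables of the [i]-th iterate or
    it has already halted at a fixpoint. At the index where the iterates become stationary no node
    finds a new tuple, so the engine halts there at the latest. *)
Lemma engine_halts : exists S i, run_halts S i.
Proof.
have [n Hn] := fp_stage_stops V E F.
have H i : (exists S, stage_begins S i) \/ exists S i, run_halts S i.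
  elim: i => [|i [[S [tbl [extra [tbl_ok ex_ok run_S]]]]|]]; last by right.
    left; exists Delta, (fun _ => [::]), (fun _ => [::]); split=> // [v vV cs|v vV].
      by split=> // -[a []].
    exact: run_first_stage.
  have Hend := run_stage_end tbl_ok ex_ok run_S.
  have Htab := next_table tbl_ok ex_ok.
  have Hnew := no_new_tuples tbl_ok ex_ok.
  case Hh: (has (fun u => new_tuples tbl extra u != [::]) V) Hend Hnew => Hend Hnew.
    left; exists (S + eval_rounds V E F + maxn 1 Delta), (fun v => new_tuples tbl extra v ++ tbl v),
      (late_informs S tbl extra); split=> // v.
    by rewrite /late_informs; case: ifP.
  have Hfix : fp_stage V E F i.+1 =1 fp_stage V E F i by apply/Hnew.
  right; exists (S + eval_rounds V E F + maxn 1 Delta), i; split=> // v vV.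
  exists (new_tuples tbl extra v ++ tbl v).
    by rewrite Hend.
  exact: eq_table_of Hfix (Htab v vV).
case: (H n) => // -[S [tbl [extra [tbl_ok ex_ok run_S]]]].
have Hend := run_stage_end tbl_ok ex_ok run_S.
have Hnew : ~~ has (fun u => new_tuples tbl extra u != [::]) V.
  exact/(no_new_tuples tbl_ok ex_ok).
exists (S + eval_rounds V E F + maxn 1 Delta), n; split=> // v vV.
exists (new_tuples tbl extra v ++ tbl v).
  by rewrite Hend // (negbTE Hnew).
exact: eq_table_of Hn (next_table tbl_ok ex_ok vV).
Qed.

Lemma halted_stays t k v : halted (run t v).1 -> (run (t + k) v).1 = (run t v).1.
Proof.
move=> Ht; elim: k => [|k IH]; first by rewrite addn0.
by rewrite addnS runS IH; case: (run t v).1 Ht.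
Qed.

(** [produces] may be witnessed by any halting round. Halted states persist, so two such rounds [S]
    and [t] show the same tables, as comparison with round [S + t] tells. *)
Lemma produces_stage i (I : l.+1.-tuple U -> Prop) :
  fp_stage V E F i.+1 =1 fp_stage V E F i ->
  produces V E F r I <-> forall a, I a <-> fp_stage V E F i a.
Proof.
move=> Hi; have [S [j [Hj HS]]] := engine_halts.
have tabS a : fp_stage V E F i a <->
    exists2 v, v \in V & tval a \in local_table (run S v).1.
  rewrite (fp_stage_unique Hi Hj); split=> [Ha|[v vV]].
    have hV : thead a \in V by move: (fp_stage_nodes Ha) => /allP/(_ _ (mem_tnth ord0 a)).
    by exists (thead a) => //; have [tb -> Htb] := HS _ hV; apply/Htb; exists a.
  by have [tb -> Htb] := HS v vV => /Htb[a' [/val_inj -> _]].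
have haltS : {in V, forall v, halted (run S v).1} by move=> v /HS[tb -> _].
split=> [[t [haltt HI]] a|HI]; last first.
  by exists S; split=> // a; rewrite HI.
have same v : v \in V -> (run S v).1 = (run t v).1.
  move=> vV; rewrite -(halted_stays t (haltS v vV)) -(halted_stays S (haltt v vV)).
  by rewrite addnC.
rewrite HI tabS; split=> -[v vV Hv]; exists v => //; by rewrite ?same // -?same.
Qed.

End FixpointEngine.

Theorem theorem4 (disp : Order.disp_t) (U : orderType disp)
    (U_infinite : infinite_type U) (D : nat) (N : network U D)
    (l : nat) (F : fpformula U l)
    (F_consts : {subset consts (fp_body F) <= nodes N})
    (I : l.+1.-tuple U -> Prop) :
  fp_models N F I <-> fp_derives N F I.
Proof.
set V := enum_fset (nodes N).
have V_neq0 : V != [::].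
  apply: contraNneq (nodes_neq0 N) => V0; apply/eqP/fsetP => x.
  by rewrite -[x \in nodes N]/(x \in V) V0.
have walks : {in V &, forall u v, walk V (edge N) (diam V (edge N)) u v}.
  apply: connected_walk_diam; [exact: edge_nodes|exact: edge_connected].
have prodP r i : r \in V -> fp_stage V (edge N) F i.+1 =1 fp_stage V (edge N) F i ->
    produces V (edge N) F r I <-> forall a, I a <-> fp_stage V (edge N) F i a.
  move=> rV; apply: produces_stage => //; [exact: edge_nodes|exact: edge_sym].
split=> [[i [Hi HI]] W r rV|H].
  by have [_] := prodP r i rV Hi; apply.
have [i Hi] := fp_stage_stops V (edge N) F.
(* [fp_derives] concerns all requesting nodes; one suffices here, and it exists because the network
   is not empty. *)
have [r rV] : exists r, r \in V by case: (V) V_neq0 => // r s _; exists r; rewrite inE eqxx.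
by exists i; split=> //; have [prodI _] := prodP r i rV Hi; apply: prodI (H r rV).
Qed.
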